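(* Every connected orthotoric Kähler surface is a QCH Kähler surface.
   Context: A Kähler surface is a Kähler manifold $(M,g,J)$ of real dimension $4$, with Kähler form $\omega=g(J\cdot,\cdot)$. The curvature tensor is $R(X,Y)Z=([\nabla_X,\nabla_Y]-\nabla_{[X,Y]})Z$, $R(X,Y,Z,W)=g(R(X,Y)Z,W)$. A Kähler surface $(M,g,J)$ is orthotoric if it admits two independent (linearly independent at every point) Hamiltonian Killing vector fields with Poisson commuting momentum maps $\xi\eta$ and $\xi+\eta$ (where $\xi,\eta$ are smooth functions on $M$) such that $d\xi$ and $d\eta$ are orthogonal. A connected Kähler surface $(M,g,J)$ is a QCH Kähler surface (QCH manifold) if there is a global smooth $J$-invariant $2$-dimensional distribution $\mathcal{D}\subset TM$ such that, for every $x\in M$ and every unit vector $X\in T_xM$, the holomorphic sectional curvature $R(X,JX,JX,X)$ depends only on $x$ and on $|X_{\mathcal{D}}|$, where $X_{\mathcal{D}}$ is the orthogonal projection of $X$ on $\mathcal{D}$. *)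

(* Defs.v *)
From HB Require Import structures.
From mathcomp Require Import all_boot all_order all_algebra.
From mathcomp Require Import all_classical all_reals all_analysis.

Set Implicit Arguments.
Unset Strict Implicit.
Unset Printing Implicit Defensive.

Import Order.TTheory GRing.Theory Num.Theory.
Import numFieldNormedType.Exports.

Local Open Scope classical_set_scope.
Local Open Scope ring_scope.

(* Tangent vectors are ROW vectors, so an endomorphism field J acts by v *m J,
   and a map f pushes v forward to v *m jacobian f u.  Tensor fields are given
   by their components in every chart, as functions of the coordinates
   u : 'rV_n, subject to the usual transformation law on overlaps; values
   outside the (open) image of the chart are irrelevant. *)

Section Local.
Context {R : realType} {n : nat}.
Implicit Types (U : set 'rV[R]_n) (u v w : 'rV[R]_n).

Definition pderiv (V : normedModType R) (i : 'I_n) (f : 'rV[R]_n -> V) :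
  'rV[R]_n -> V := fun u => 'D_(delta_mx 0 i) f u.

(* C^infty: the iterated partial derivatives of every order are
   (Frechet-)differentiable, hence also continuous, on the open set U. *)
Definition smooth_on (V : normedModType R) U (f : 'rV[R]_n -> V) : Prop :=
  forall (s : seq 'I_n) u, U u -> differentiable (foldr (@pderiv V) f s) u.

Definition pairing (G : 'M[R]_n) v w : R := (v *m G *m w^T) 0 0.

Definition bracket (X Y : 'rV[R]_n -> 'rV[R]_n) : 'rV[R]_n -> 'rV[R]_n :=
  fun u => 'D_(X u) Y u - 'D_(Y u) X u.

Section Metric.
Variable G : 'rV[R]_n -> 'M[R]_n.

(* christoffel u i j k is Gamma^k_(ij). *)
Definition christoffel u (i j k : 'I_n) : R :=
  2^-1 * \sum_(l < n) invmx (G u) k l *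
    (pderiv i (fun u' => G u' j l) u + pderiv j (fun u' => G u' i l) u
     - pderiv l (fun u' => G u' i j) u).

Definition nabla (X Y : 'rV[R]_n -> 'rV[R]_n) : 'rV[R]_n -> 'rV[R]_n :=
  fun u => 'D_(X u) Y u +
    \row_k \sum_(i < n) \sum_(j < n) X u 0 i * Y u 0 j * christoffel u i j k.

Definition curvature_op (X Y Z : 'rV[R]_n -> 'rV[R]_n) :
  'rV[R]_n -> 'rV[R]_n :=
  fun u => nabla X (nabla Y Z) u - nabla Y (nabla X Z) u
           - nabla (bracket X Y) Z u.

(* By tensoriality the value on tangent vectors at u may be computed on any
   local extensions; those with constant components are used here. *)
Definition curvature u (x y z w : 'rV[R]_n) : R :=
  pairing (G u) (curvature_op (cst x) (cst y) (cst z) u) w.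

Definition lie_metric (K X Y : 'rV[R]_n -> 'rV[R]_n) u : R :=
  'D_(K u) (fun u' => pairing (G u') (X u') (Y u')) u
  - pairing (G u) (bracket K X u) (Y u) - pairing (G u) (X u) (bracket K Y u).

Definition killing_on U (K : 'rV[R]_n -> 'rV[R]_n) : Prop :=
  forall X Y, smooth_on U X -> smooth_on U Y ->
    forall u, U u -> lie_metric K X Y u = 0.

Definition parallel_on U (J : 'rV[R]_n -> 'M[R]_n) : Prop :=
  forall X Y, smooth_on U X -> smooth_on U Y ->
    forall u, U u ->
      nabla X (fun u' => Y u' *m J u') u = nabla X Y u *m J u.

End Metric.

(* P is the orthogonal projection of v on the row space of D. *)
Definition is_orth_proj (G D : 'M[R]_n) v (P : 'rV[R]_n) : Prop :=
  (P <= D)%MS /\ forall w, (w <= D)%MS -> pairing G (v - P) w = 0.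

End Local.

Record smooth_manifold (R : realType) (n : nat) := SmoothManifold {
  mcarrier :> topologicalType;
  mhausdorff : hausdorff_space mcarrier;
  msecond_countable : @second_countable mcarrier;
  chart : Type;
  cdom : chart -> set mcarrier;
  cmap : chart -> mcarrier -> 'rV[R]_n;
  cinv : chart -> 'rV[R]_n -> mcarrier;
  cdom_cover : forall x, exists c, cdom c x;
  cdom_open : forall c, open (cdom c);
  cimg_open : forall c, open (cmap c @` cdom c);
  cmapK : forall c x, cdom c x -> cinv c (cmap c x) = x;
  cmap_continuous : forall c x, cdom c x -> {for x, continuous (cmap c)};
  cinv_continuous : forall c x, cdom c x ->
    {for cmap c x, continuous (cinv c)};
  ctransition_smooth : forall c c',
    smooth_on (cmap c @` (cdom c `&` cdom c')) (cmap c' \o cinv c) }.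

Section Manifold.
Context {R : realType} {n : nat} (M : smooth_manifold R n).

Definition cimg (c : chart M) : set 'rV[R]_n := cmap c @` cdom c.

Definition overlap (c c' : chart M) : set M := cdom c `&` cdom c'.

Definition cjac (c c' : chart M) (x : M) : 'M[R]_n :=
  jacobian (cmap c' \o cinv c) (cmap c x).

Definition smooth_function (f : M -> R) : Prop :=
  forall c, smooth_on (cimg c) (f \o cinv c).

Definition is_vector_field (X : chart M -> 'rV[R]_n -> 'rV[R]_n) : Prop :=
  (forall c, smooth_on (cimg c) (X c)) /\
  (forall c c' x, overlap c c' x ->
     X c (cmap c x) *m cjac c c' x = X c' (cmap c' x)).

Definition is_endomorphism_field (J : chart M -> 'rV[R]_n -> 'M[R]_n) : Prop :=
  (forall c, smooth_on (cimg c) (J c)) /\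
  (forall c c' x, overlap c c' x ->
     J c (cmap c x) *m cjac c c' x = cjac c c' x *m J c' (cmap c' x)).

Definition is_riemannian_metric (G : chart M -> 'rV[R]_n -> 'M[R]_n) : Prop :=
  [/\ forall c, smooth_on (cimg c) (G c),
      forall c c' x, overlap c c' x ->
        G c (cmap c x) = cjac c c' x *m G c' (cmap c' x) *m (cjac c c' x)^T,
      forall c u, cimg c u -> (G c u)^T = G c u &
      forall c u v, cimg c u -> v != 0 -> 0 < pairing (G c u) v v].

(* A distribution is given by matrices whose row spaces are its fibres;
   smoothness is the existence of smooth local frames. *)
Definition is_distribution (k : nat) (D : chart M -> 'rV[R]_n -> 'M[R]_n) :
  Prop :=
  [/\ forall c u, cimg c u -> \rank (D c u) = k,
      forall c c' x, overlap c c' x ->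
        (D c (cmap c x) *m cjac c c' x == D c' (cmap c' x))%MS &
      forall c u, cimg c u -> exists U (F : 'rV[R]_n -> 'M[R]_(k, n)),
        [/\ open U, U u, U `<=` cimg c, smooth_on U F &
            forall u', U u' -> (F u' == D c u')%MS]].

End Manifold.

Record kahler_manifold (R : realType) (n : nat) := KahlerManifold {
  kmanifold :> smooth_manifold R n;
  kmetric : chart kmanifold -> 'rV[R]_n -> 'M[R]_n;
  kcomplex : chart kmanifold -> 'rV[R]_n -> 'M[R]_n;
  kmetricP : is_riemannian_metric kmetric;
  kcomplexP : is_endomorphism_field kcomplex;
  kcomplex_sqr : forall c u, cimg c u ->
    kcomplex c u *m kcomplex c u = - 1%:M;
  khermitian : forall c u v w, cimg c u ->
    pairing (kmetric c u) (v *m kcomplex c u) (w *m kcomplex c u)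
    = pairing (kmetric c u) v w;
  kparallel : forall c, parallel_on (kmetric c) (cimg c) (kcomplex c) }.

Definition kahler_surface (R : realType) := kahler_manifold R 4.

Section Kahler.
Context {R : realType} {n : nat} (M : kahler_manifold R n).

Definition kahler_form (c : chart M) (u v w : 'rV[R]_n) : R :=
  pairing (kmetric c u) (v *m kcomplex c u) w.

Definition is_killing (K : chart M -> 'rV[R]_n -> 'rV[R]_n) : Prop :=
  forall c, killing_on (kmetric c) (cimg c) (K c).

(* Sign convention: iota_K omega = - d mu, i.e. K = J grad mu. *)
Definition is_momentum_map (K : chart M -> 'rV[R]_n -> 'rV[R]_n)
    (mu : M -> R) : Prop :=
  forall c u v, cimg c u ->
    kahler_form c u (K c u) v = - 'D_v (mu \o cinv c) u.

Definition hamiltonian_killing (K : chart M -> 'rV[R]_n -> 'rV[R]_n)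
    (mu : M -> R) : Prop :=
  [/\ is_vector_field K, is_killing K & is_momentum_map K mu].

Definition differential (f : M -> R) (c : chart M) (u : 'rV[R]_n) :
  'rV[R]_n := \row_i pderiv i (f \o cinv c) u.

(* The metric induced on T*M has components the inverse matrix. *)
Definition orthogonal_differentials (f h : M -> R) : Prop :=
  forall c u, cimg c u ->
    pairing (invmx (kmetric c u)) (differential f c u) (differential h c u)
    = 0.

Definition holomorphic_sectional (c : chart M) (u X : 'rV[R]_n) : R :=
  let JX := X *m kcomplex c u in curvature (kmetric c) u X JX JX X.

End Kahler.

(* The Poisson bracket of the momentum maps is omega(K1, K2). *)
Definition orthotoric (R : realType) (M : kahler_surface R) : Prop :=
  exists (xi eta : M -> R) (K1 K2 : chart M -> 'rV[R]_4 -> 'rV[R]_4),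
    [/\ smooth_function xi /\ smooth_function eta,
        hamiltonian_killing K1 (fun x => xi x * eta x) /\
        hamiltonian_killing K2 (fun x => xi x + eta x),
        forall c u, cimg c u -> \rank (col_mx (K1 c u) (K2 c u)) = 2,
        forall c u, cimg c u -> kahler_form c u (K1 c u) (K2 c u) = 0 &
        orthogonal_differentials xi eta].

(* |P| for a tangent vector P is Num.sqrt (g(P, P)). *)
Definition QCH (R : realType) (M : kahler_surface R) : Prop :=
  connected [set: M] /\
  exists D : chart M -> 'rV[R]_4 -> 'M[R]_4,
    [/\ is_distribution 2 D,
        forall c u, cimg c u -> (D c u *m kcomplex c u <= D c u)%MS &
        forall c u, cimg c u -> forall X Y P Q : 'rV[R]_4,
          pairing (kmetric c u) X X = 1 -> pairing (kmetric c u) Y Y = 1 ->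
          is_orth_proj (kmetric c u) (D c u) X P ->
          is_orth_proj (kmetric c u) (D c u) Y Q ->
          Num.sqrt (pairing (kmetric c u) P P)
          = Num.sqrt (pairing (kmetric c u) Q Q) ->
          holomorphic_sectional c u X = holomorphic_sectional c u Y].

(* Main.v *)
Require Import Defs.
From mathcomp Require Import all_boot all_order all_algebra.
From mathcomp Require Import all_classical all_reals all_analysis.
From mathcomp Require Import ring lra.

(** The theorem is local on M except for the construction of the
distribution, so most of the work takes place in one chart.

Put a = grad xi, b = grad eta.  The momentum equations say that the Killing
fields are K2 = J (a + b) and K1 = J (xi b + eta a); their independence forces
xi <> eta, a <> 0, b <> 0, and Poisson commutation becomes g (J a) b = 0.  Since
also g a b = 0, the vectors a, J a, b, J b form an orthogonal frame, and D is
the complex line spanned by a and J a.  It is generated by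
K1 - xi K2 = (eta - xi) J a, an expression that visibly transforms as a
vector field (local_curvature, line_generatorE).

Let P and Q be the Hessians of xi and eta, seen as endomorphisms.  That
K1 and K2 are Killing says that P + Q and the Hessian of xi eta commute with J;
as xi and eta are the roots of t^2 - (xi + eta) t + xi eta, this determines
the J-anti-invariant parts of P and Q algebraically in terms of a and b.
Differentiating g a b = 0 and g (J a) b = 0 gives two more relations, and
together they determine P and Q up to two scalar functions p and q (hessian_Pa
to hessian_QbJ).  In particular
  2 (xi - eta) g (nabla_y a) b = |a|^2 g y b + |b|^2 g y a
and its analogue for J b hold identically.  (These say that the endomorphism
equal to xi on D and to eta on its complement solves the Hamiltonian 2-form
equation.)  Differentiating them once more and antisymmetrising expresses the
curvature components R(x,y,a,b) and R(x,y,a,Jb) through a, b, P and Q: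
  R(x,y,a,b) = c (a^b + Ja^Jb)(x,y),  R(x,y,a,Jb) = c (a^Jb - Ja^b)(x,y)
for a function c (curvature_ab_of_hessians, curvature_abJ_of_hessians); p and q
enter only through c.

By the symmetries of a Kaehler curvature tensor these formulas kill all the
components that could make R(X,JX,JX,X) depend on the phases of the two
complex coordinates of X: it is a quadratic polynomial in the squared norms of
the components of X along D and its complement (holomorphic_sectional_frame).
For a unit vector the second norm is determined by the first, which is the QCH
condition.

All derivatives are computed with vectors that are constant in the chart.
This needs the symmetry of second derivatives, the Levi-Civita calculus
(metric compatibility, vanishing torsion, tensoriality and symmetries of the
curvature) and the stability of smoothness under algebraic operations. *)

Set Implicit Arguments.
Unset Strict Implicit.
Unset Printing Implicit Defensive.

Import Order.TTheory GRing.Theory Num.Theory.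
Import numFieldNormedType.Exports.

Local Open Scope classical_set_scope.
Local Open Scope ring_scope.

(** * Smooth maps on an open set of coordinate space *)

(** The difference g - f vanishes near x, hence is differentiable there. *)
Lemma near_eq_differentiable (R : realType) (V W : normedModType R)
    (f g : V -> W) (x : V) :
  (\near x, f x = g x) -> differentiable f x -> differentiable g x.
Proof.
move=> fg df.
have h0 : differentiable (g - f) x.
  have E : (g - f) \o shift x =
      cst ((g - f) x) + (\0 : {linear V -> W}) +o_ (0 : V) id.
    apply/eqaddoP => _/posnumP[e].
    have := fg; rewrite (near_shift 0) subr0 => fg0.
    near=> y; rewrite !fctE /= (nbhs_singleton fg) subrr addr0 subr0.
    have -> : f (y + x) = g (y + x) by near: y; exact: fg0.
    by rewrite subrr normr0 mulr_ge0.
  apply/diff_locallyP; rewrite (diff_unique _ E); last exact: cst_continuous.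
  by split; [exact: cst_continuous|exact: E].
by have := differentiableD df h0; rewrite addrC subrK.
Unshelve. all: by end_near. Qed.

Section SmoothOn.
Context {R : realType} {n : nat} (U : set 'rV[R]_n).
Hypothesis openU : open U.

Lemma near_open (P : 'rV[R]_n -> Prop) u :
  U u -> (forall v, U v -> P v) -> \forall v \near u, P v.
Proof.
move=> Uu PU; apply: filterS (open_nbhs_nbhs _); last by split; [exact: openU|].
by move=> v; exact: PU.
Qed.

Lemma smooth_on_diff (V : normedModType R) (f : 'rV[R]_n -> V) u :
  smooth_on U f -> U u -> differentiable f u.
Proof. by move=> + Uu; move/(_ [::] u Uu). Qed.

Lemma smooth_on_derivable (V : normedModType R) (f : 'rV[R]_n -> V) u v :
  smooth_on U f -> U u -> derivable f u v.
Proof. by move=> fs Uu; exact/diff_derivable/(smooth_on_diff fs). Qed.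

Lemma smooth_on_pderiv (V : normedModType R) (f : 'rV[R]_n -> V) i :
  smooth_on U f -> smooth_on U (pderiv i f).
Proof. by move=> fs s u Uu; have := fs (rcons s i) u Uu; rewrite foldr_rcons. Qed.

(** Coinduction: smoothness of f holds as soon as f lies in a class of
differentiable functions that is stable, up to equality on U, under partial
derivatives.  It replaces a Leibniz formula for iterated derivatives in the
closure properties below. *)
Lemma smooth_on_coind (V : normedModType R) (P : ('rV[R]_n -> V) -> Prop) :
  (forall f u, P f -> U u -> differentiable f u) ->
  (forall f i, P f -> exists2 g, P g & forall u, U u -> pderiv i f u = g u) ->
  forall f, P f -> smooth_on U f.
Proof.
move=> Pdiff Pder.
have H s : forall f, P f ->
    exists2 g, P g & forall u, U u -> foldr (@pderiv R n V) f s u = g u.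
  elim: s => [|i s IH] f Pf /=; first by exists f.
  have [g Pg fg] := IH f Pf; have [h Ph gh] := Pder g i Pg.
  exists h => // u Uu; rewrite -gh//; apply: near_eq_derive.
  exact: near_open.
move=> f Pf s u Uu; have [g Pg fg] := H s f Pf.
apply: near_eq_differentiable (Pdiff g u Pg Uu).
by apply: near_open => // v Uv; rewrite fg.
Qed.

Lemma eq_smooth_on (V : normedModType R) (f g : 'rV[R]_n -> V) :
  (forall u, U u -> f u = g u) -> smooth_on U f -> smooth_on U g.
Proof.
move=> fg fs.
apply: (@smooth_on_coind _ (fun g => exists2 f, smooth_on U f &
   forall u, U u -> f u = g u)); last by exists f.
- move=> {fg fs}g u [{}f fs fg] Uu.
  apply: near_eq_differentiable (smooth_on_diff fs Uu).
  exact: near_open.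
- move=> {fg fs}g i [{}f fs fg]; exists (pderiv i f).
    by exists (pderiv i f) => //; exact: smooth_on_pderiv.
  move=> u Uu; apply: near_eq_derive; apply: near_open => // v Uv.
  by rewrite fg.
Qed.

Lemma smooth_on_cst (V : normedModType R) (a : V) : smooth_on U (cst a).
Proof.
apply: (@smooth_on_coind _ (fun f => exists a, f = cst a)); last by exists a.
  by move=> f u [b ->] _; exact: differentiable_cst.
move=> f i [b ->]; exists (cst 0); first by exists 0.
by move=> u _; rewrite /pderiv derive_cst.
Qed.

(** The class used to prove closure under sum, product and inverse at once:
partial derivatives of such an expression are again such expressions,
although a single product or quotient is not stable by itself. *)
Inductive smooth_expr : ('rV[R]_n -> R) -> Prop :=
| smooth_atom f : smooth_on U f -> smooth_expr f
| smooth_add f g : smooth_expr f -> smooth_expr g ->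
    smooth_expr (fun u => f u + g u)
| smooth_mul f g : smooth_expr f -> smooth_expr g ->
    smooth_expr (fun u => f u * g u)
| smooth_inv f : smooth_expr f -> (forall u, U u -> f u != 0) ->
    smooth_expr (fun u => (f u)^-1).

Lemma smooth_expr_diff f u : smooth_expr f -> U u -> differentiable f u.
Proof.
move=> + Uu; elim=> {f}.
- by move=> f /smooth_on_diff; apply.
- by move=> f g _ df _ dg; exact: differentiableD.
- by move=> f g _ df _ dg; exact: differentiableM.
- by move=> f _ df f0; apply: differentiableV => //; exact: f0.
Qed.

Lemma smooth_exprP f : smooth_expr f -> smooth_on U f.
Proof.
move: f; apply: smooth_on_coind; first exact: smooth_expr_diff.
move=> f i; elim=> {f}.
- by move=> f fs; exists (pderiv i f) => //; apply/smooth_atom/smooth_on_pderiv.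
- move=> f g ef [f' ef' ff'] eg [g' eg' gg'].
  exists (fun u => f' u + g' u); first exact: smooth_add.
  move=> u Uu; rewrite -ff'// -gg'// /pderiv deriveD//;
    exact/diff_derivable/smooth_expr_diff.
- move=> f g ef [f' ef' ff'] eg [g' eg' gg'].
  exists (fun u => f u * g' u + g u * f' u).
    by apply: smooth_add; exact: smooth_mul.
  move=> u Uu; rewrite -ff'// -gg'// /pderiv deriveM//;
    exact/diff_derivable/smooth_expr_diff.
- move=> f ef [f' ef' ff'] f0.
  exists (fun u => (-1 * ((f u)^-1 * (f u)^-1)) * f' u).
    apply: smooth_mul => //; apply: smooth_mul.
      exact/smooth_atom/smooth_on_cst.
    by apply: smooth_mul; exact: smooth_inv.
  move=> u Uu; rewrite -ff'// /pderiv deriveV.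
  + by rewrite mulN1r -invrM ?unitfE ?f0// -expr2.
  + exact: f0.
  + exact/diff_derivable/smooth_expr_diff.
Qed.

Lemma smooth_onD (f g : 'rV[R]_n -> R) : smooth_on U f -> smooth_on U g ->
  smooth_on U (fun u => f u + g u).
Proof.
by move=> fs gs; apply/smooth_exprP/smooth_add; exact: smooth_atom.
Qed.

Lemma smooth_onM (f g : 'rV[R]_n -> R) : smooth_on U f -> smooth_on U g ->
  smooth_on U (fun u => f u * g u).
Proof.
by move=> fs gs; apply/smooth_exprP/smooth_mul; exact: smooth_atom.
Qed.

Lemma smooth_onV (f : 'rV[R]_n -> R) : smooth_on U f ->
  (forall u, U u -> f u != 0) -> smooth_on U (fun u => (f u)^-1).
Proof.
by move=> fs f0; apply/smooth_exprP/smooth_inv => //; exact: smooth_atom.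
Qed.

Lemma smooth_on_sum (I : Type) (r : seq I) (P : pred I)
    (f : I -> 'rV[R]_n -> R) :
  (forall i, P i -> smooth_on U (f i)) ->
  smooth_on U (fun u => \sum_(i <- r | P i) f i u).
Proof.
move=> fs; elim: r => [|i r IH].
  by apply: (eq_smooth_on _ (smooth_on_cst (0 : R))) => u _; rewrite big_nil.
case Pi: (P i); last first.
  by apply: (eq_smooth_on _ IH) => u _; rewrite big_cons Pi.
apply: (eq_smooth_on _ (smooth_onD (fs i Pi) IH)) => u _.
by rewrite big_cons Pi.
Qed.

Lemma smooth_on_prod (I : Type) (r : seq I) (P : pred I)
    (f : I -> 'rV[R]_n -> R) :
  (forall i, P i -> smooth_on U (f i)) ->
  smooth_on U (fun u => \prod_(i <- r | P i) f i u).
Proof.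
move=> fs; elim: r => [|i r IH].
  by apply: (eq_smooth_on _ (smooth_on_cst (1 : R))) => u _; rewrite big_nil.
case Pi: (P i); last first.
  by apply: (eq_smooth_on _ IH) => u _; rewrite big_cons Pi.
apply: (eq_smooth_on _ (smooth_onM (fs i Pi) IH)) => u _.
by rewrite big_cons Pi.
Qed.

Lemma derive_entry m k (A : 'rV[R]_n -> 'M[R]_(m, k)) i j u v :
  differentiable A u -> 'D_v (fun u => A u i j) u = 'D_v A u i j.
Proof. by move=> dA; rewrite derive_mx ?mxE//; exact: diff_derivable. Qed.

Lemma differentiable_entry m k (A : 'rV[R]_n -> 'M[R]_(m, k)) i j u :
  differentiable A u -> differentiable (fun u => A u i j) u.
Proof.
move=> dA; apply: (@differentiable_comp _ _ _ _ A
  (fun N : 'M[R]_(m, k) => N i j : R)) => //.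
exact: differentiable_coord.
Qed.

Lemma differentiable_mx m k (A : 'rV[R]_n -> 'M[R]_(m, k)) u :
  (forall i j, differentiable (fun u => A u i j) u) -> differentiable A u.
Proof.
move=> dA.
have -> : A = \sum_(i < m) \sum_(j < k) (fun u => A u i j *: delta_mx i j).
  apply/funext => v; rewrite {1}[A v]matrix_sum_delta fct_sumE.
  by apply: eq_bigr => i _; rewrite fct_sumE.
apply: differentiable_sum => i; apply: differentiable_sum => j.
exact: differentiableZl.
Qed.

Lemma smooth_on_entry m k (A : 'rV[R]_n -> 'M[R]_(m, k)) i j :
  smooth_on U A -> smooth_on U (fun u => A u i j).
Proof.
move=> As; pose P (f : 'rV[R]_n -> R) := exists2 B : 'rV[R]_n -> 'M[R]_(m, k),
  smooth_on U B & f = (fun u => B u i j).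
apply: (@smooth_on_coind _ P); last by exists A.
- move=> {As}f u [{}A As ->] Uu; apply: differentiable_entry.
  exact: smooth_on_diff As Uu.
- move=> {As}f l [{}A As ->]; exists (fun u => pderiv l A u i j).
    by exists (pderiv l A) => //; exact: smooth_on_pderiv.
  by move=> u Uu; rewrite /pderiv derive_entry//; exact: smooth_on_diff As Uu.
Qed.

Lemma smooth_on_mx m k (A : 'rV[R]_n -> 'M[R]_(m, k)) :
  (forall i j, smooth_on U (fun u => A u i j)) -> smooth_on U A.
Proof.
pose P (B : 'rV[R]_n -> 'M[R]_(m, k)) :=
  forall i j, smooth_on U (fun u => B u i j).
move=> As; apply: (@smooth_on_coind _ P) => //.
- move=> B u PB Uu; apply: differentiable_mx => i j.
  exact: smooth_on_diff (PB i j) Uu.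
- move=> B l PB; exists (pderiv l B) => // i j.
  apply: (eq_smooth_on _ (smooth_on_pderiv l (PB i j))) => u Uu.
  rewrite /pderiv derive_entry//; apply: differentiable_mx => i' j'.
  exact: smooth_on_diff (PB i' j') Uu.
Qed.

Lemma smooth_on_mulmx m k l (A : 'rV[R]_n -> 'M[R]_(m, k))
    (B : 'rV[R]_n -> 'M[R]_(k, l)) :
  smooth_on U A -> smooth_on U B -> smooth_on U (fun u => A u *m B u).
Proof.
move=> As Bs; apply: smooth_on_mx => i j.
apply: (eq_smooth_on (f := fun u => \sum_s A u i s * B u s j)).
  by move=> u _; rewrite mxE.
by apply: smooth_on_sum => s _; apply: smooth_onM; exact: smooth_on_entry.
Qed.

Lemma smooth_on_addmx m k (A B : 'rV[R]_n -> 'M[R]_(m, k)) :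
  smooth_on U A -> smooth_on U B -> smooth_on U (fun u => A u + B u).
Proof.
move=> As Bs; apply: smooth_on_mx => i j.
apply: (eq_smooth_on (f := fun u => A u i j + B u i j)).
  by move=> u _; rewrite mxE.
by apply: smooth_onD; exact: smooth_on_entry.
Qed.

Lemma smooth_on_scalemx m k (f : 'rV[R]_n -> R) (A : 'rV[R]_n -> 'M[R]_(m, k)) :
  smooth_on U f -> smooth_on U A -> smooth_on U (fun u => f u *: A u).
Proof.
move=> fs As; apply: smooth_on_mx => i j.
apply: (eq_smooth_on (f := fun u => f u * A u i j)).
  by move=> u _; rewrite mxE.
by apply: smooth_onM => //; exact: smooth_on_entry.
Qed.

Lemma smooth_on_trmx m k (A : 'rV[R]_n -> 'M[R]_(m, k)) :
  smooth_on U A -> smooth_on U (fun u => (A u)^T).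
Proof.
move=> As; apply: smooth_on_mx => i j.
apply: (eq_smooth_on (f := fun u => A u j i)); last exact: smooth_on_entry.
by move=> u _; rewrite mxE.
Qed.

Lemma smooth_on_det k (A : 'rV[R]_n -> 'M[R]_k) :
  smooth_on U A -> smooth_on U (fun u => \det (A u)).
Proof.
move=> As; apply: smooth_on_sum => s _; apply: smooth_onM.
  exact: smooth_on_cst.
by apply: smooth_on_prod => i _; exact: smooth_on_entry.
Qed.

(** Cramer's rule reduces this to determinants, which are polynomials. *)
Lemma smooth_on_invmx k (A : 'rV[R]_n -> 'M[R]_k) :
  (forall u, U u -> A u \in unitmx) ->
  smooth_on U A -> smooth_on U (fun u => invmx (A u)).
Proof.
move=> Au As; apply: (eq_smooth_on (f := fun u => (\det (A u))^-1 *: \adj (A u))).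
  by move=> u Uu; rewrite /invmx Au.
apply: smooth_on_scalemx.
  apply: smooth_onV; first exact: smooth_on_det.
  by move=> u /Au; rewrite unitmxE unitfE.
apply: smooth_on_mx => i j.
apply: (eq_smooth_on (f := fun u => cofactor (A u) j i)).
  by move=> u _; rewrite mxE.
apply: smooth_onM; first exact: smooth_on_cst.
apply: smooth_on_det; apply: smooth_on_mx => s t.
apply: (eq_smooth_on (f := fun u => A u (lift j s) (lift i t))).
  by move=> u _; rewrite !mxE.
exact: smooth_on_entry.
Qed.

Lemma derive_sum_pderiv (V : normedModType R) (f : 'rV[R]_n -> V) x u :
  differentiable f u -> 'D_x f u = \sum_i x 0 i *: pderiv i f u.
Proof.
move=> df; rewrite deriveE// [x in LHS]row_sum_delta linear_sum.
by apply: eq_bigr => i _; rewrite linearZ /= /pderiv deriveE.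
Qed.

Lemma smooth_on_derive m k (A : 'rV[R]_n -> 'M[R]_(m, k)) x :
  smooth_on U A -> smooth_on U (fun u => 'D_x A u).
Proof.
move=> As; apply: smooth_on_mx => i j.
apply: (eq_smooth_on (f := fun u => \sum_l x 0 l * pderiv l A u i j)).
  move=> u Uu; rewrite derive_sum_pderiv ?summxE; last exact: smooth_on_diff As Uu.
  by apply: eq_bigr => l _; rewrite mxE.
apply: smooth_on_sum => l _; apply: smooth_onM; first exact: smooth_on_cst.
exact/smooth_on_entry/smooth_on_pderiv.
Qed.

End SmoothOn.

(** * Symmetry of second derivatives *)

Section Schwarz.
Context {R : realType} {V : normedModType R}.
Implicit Types (f : V -> R) (u x y w : V).

Lemma is_derive_line f x w (s : R) : differentiable f (s *: x + w) ->
  is_derive s 1 (fun t : R => f (t *: x + w)) ('D_x f (s *: x + w)).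
Proof.
move=> df; have dx := @diff_derivable _ _ _ _ _ x df.
have E : (fun h : R => h^-1 *: (f (h *: x + (s *: x + w)) - f (s *: x + w))) =
  (fun h : R => h^-1 *: ((fun t : R => f (t *: x + w)) (h *: 1 + s) -
                      (fun t : R => f (t *: x + w)) s)).
  by apply/funext => h /=; rewrite addrA -scalerDl [_%:A]mulr1.
by apply: DeriveDef; [rewrite /derivable -E|rewrite /derive -E].
Qed.

(** The mean value theorem in the direction x, applied to the increment of f
in the direction y, and then in the direction y, applied to 'D_x f. *)
Lemma second_difference f x y u (h : R) : 0 < h ->
  (forall s t, 0 <= s <= h -> 0 <= t <= h ->
     differentiable f (s *: x + (t *: y + u)) /\
     differentiable ('D_x f) (s *: x + (t *: y + u))) ->
  exists s t, [/\ 0 <= s <= h, 0 <= t <= h &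
    f (h *: x + (h *: y + u)) - f (h *: x + u) - (f (h *: y + u) - f u) =
    'D_y ('D_x f) (s *: x + (t *: y + u)) * h ^+ 2].
Proof.
move=> h0 df.
have hh : 0 <= h <= h by rewrite lexx ltW.
have h00 : 0 <= (0 : R) <= h by rewrite lexx ltW.
pose phi (s : R) := f (s *: x + (h *: y + u)) - f (s *: x + u).
have dphi (s : R) : 0 <= s <= h -> is_derive s 1 phi
    ('D_x f (s *: x + (h *: y + u)) - 'D_x f (s *: x + u)).
  move=> sh; apply: is_deriveB; apply: is_derive_line.
    by have [] := df s h sh hh.
  by have [] := df s 0 sh h00; rewrite scale0r add0r.
have ooW (s : R) : s \in `]0, h[%R -> 0 <= s <= h.
  by rewrite in_itv /= => /andP[s0 sh]; rewrite !ltW.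
have cont (g dg : R -> R) : (forall s, 0 <= s <= h -> is_derive s 1 g (dg s)) ->
    {within `[0, h], continuous g}.
  move=> dg'; apply: derivable_within_continuous => s; rewrite in_itv /= => sh.
  by have [] := dg' s sh.
have [s /ooW sh] := MVT h0 (fun s sh => dphi s (ooW s sh)) (cont _ _ dphi).
rewrite /phi !scale0r !add0r subr0 => ->.
pose psi (t : R) := 'D_x f (t *: y + (s *: x + u)).
have dpsi (t : R) : 0 <= t <= h -> is_derive t 1 psi
    ('D_y ('D_x f) (t *: y + (s *: x + u))).
  move=> th; apply: is_derive_line.
  by have [_] := df s t sh th; rewrite addrCA.
have [t /ooW th] := MVT h0 (fun s sh => dpsi s (ooW s sh)) (cont _ _ dpsi).
rewrite /psi scale0r add0r subr0 addrCA => ->.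
exists s, t; split=> //; by rewrite addrCA -mulrA -expr2.
Qed.

(** The second difference is symmetric in x and y, so both mixed derivatives
take a common value at points arbitrarily close to u; continuity concludes. *)
Lemma deriveC f x y u (U : set V) : open U -> U u ->
  (forall v, U v -> differentiable f v) ->
  (forall v, U v -> differentiable ('D_x f) v) ->
  (forall v, U v -> differentiable ('D_y f) v) ->
  {for u, continuous ('D_y ('D_x f))} ->
  {for u, continuous ('D_x ('D_y f))} ->
  'D_y ('D_x f) u = 'D_x ('D_y f) u.
Proof.
move=> oU Uu df dxf dyf cyx cxy; apply/eqP; rewrite -subr_eq0 -normr_le0.
apply/ler_addgt0Pl => e e0; rewrite addr0.
have e2 : 0 < e / 2 by rewrite divr_gt0.
have close (g : V -> R) : {for u, continuous g} ->
    \forall v \near u, `|g u - g v| < e / 2.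
  by move=> /cvgrPdist_lt; apply.
have [d /= d0 dU] : exists2 d, 0 < d & forall v, ball u d v -> [/\ U v,
    `|'D_y ('D_x f) u - 'D_y ('D_x f) v| < e / 2 &
    `|'D_x ('D_y f) u - 'D_x ('D_y f) v| < e / 2].
  have n1 : nbhs u U by apply: open_nbhs_nbhs; split.
  have n2 := filterI n1 (filterI (close _ cyx) (close _ cxy)).
  have [d d0 dU] := (nbhs_ballP u _).1 (n2 _ _).
  exists d; first exact: d0.
  by move=> v /dU [Uv [A1 A2]]; split; [exact: Uv|exact: A1|exact: A2].
(* Small enough for the whole parallelogram of side h to lie in the ball. *)
pose h := d / (`|x| + `|y| + 1).
have k0 : 0 < `|x| + `|y| + 1 by rewrite ltr_pwDr// addr_ge0.
have h0 : 0 < h by rewrite divr_gt0.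
have inU (s t : R) : 0 <= s <= h -> 0 <= t <= h -> ball u d (s *: x + (t *: y + u)).
  move=> /andP[s0 sh] /andP[t0 th]; rewrite -ball_normE /ball_/= !addrA.
  rewrite distrC addrK (le_lt_trans (ler_normD _ _))// !normrZ !ger0_norm//.
  rewrite (@le_lt_trans _ _ (h * `|x| + h * `|y|))//.
    by rewrite lerD// ler_wpM2r.
  by rewrite -mulrDr /h mulrAC ltr_pdivrMr// ltr_pM2l// ltrDl.
have [s [t [sh th E1]]] := @second_difference f x y u h h0 (fun s t sh th =>
  let: And3 Ut _ _ := dU _ (inU s t sh th) in conj (df _ Ut) (dxf _ Ut)).
have inV (a b : R) : 0 <= a <= h -> 0 <= b <= h ->
    ball u d (a *: y + (b *: x + u)).
  by move=> ah bh; rewrite addrCA; exact: inU.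
have [s' [t' [sh' th' E2]]] := @second_difference f y x u h h0 (fun s t sh th =>
  let: And3 Ut _ _ := dU _ (inV s t sh th) in conj (df _ Ut) (dyf _ Ut)).
have [_ A1 _] := dU _ (inU s t sh th).
have [_ _ A2] := dU _ (inV s' t' sh' th').
have E : 'D_y ('D_x f) (s *: x + (t *: y + u)) =
         'D_x ('D_y f) (s' *: y + (t' *: x + u)).
  apply: (@mulIf _ (h ^+ 2)); first by rewrite expf_neq0// gt_eqF.
  by rewrite -E1 -E2 [in RHS]addrCA; ring.
rewrite E in A1.
have half (a b c : R) : `|a - c| < e / 2 -> `|b - c| < e / 2 -> `|a - b| <= e.
  rewrite (distrC b) => ac cb.
  by rewrite -(subrKA c) (le_trans (ler_normD _ _))// (splitr e) lerD ?ltW.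
exact: half A1 A2.
Qed.

End Schwarz.

Section SmoothSchwarz.
Context {R : realType} {n : nat} (U : set 'rV[R]_n).
Hypothesis openU : open U.

Lemma smooth_on_deriveC m k (A : 'rV[R]_n -> 'M[R]_(m, k)) x y u :
  smooth_on U A -> U u -> 'D_x ('D_y A) u = 'D_y ('D_x A) u.
Proof.
move=> As Uu.
have E (a : 'rV[R]_n) i j v : U v -> 'D_a (fun u => A u i j) v = 'D_a A v i j.
  by move=> Uv; apply: derive_entry; exact: smooth_on_diff As Uv.
have sx a := smooth_on_derive openU a As.
have sxx a b := smooth_on_derive openU a (sx b).
have E2 (a b : 'rV[R]_n) i j v : U v ->
    'D_a ('D_b (fun u => A u i j)) v = 'D_a ('D_b A) v i j.
  move=> Uv; rewrite -derive_entry; last exact: smooth_on_diff (sx b) Uv.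
  by apply: near_eq_derive; apply: (near_open openU Uv) => w Uw; rewrite E.
apply/matrixP => i j.
apply: etrans (esym (E2 x y i j u Uu)) _.
apply: etrans (E2 y x i j u Uu).
have se := smooth_on_entry openU i j As.
have dse a v : U v -> differentiable ('D_a (fun u => A u i j)) v.
  move=> Uv; apply: (@near_eq_differentiable _ _ _ (fun u => 'D_a A u i j)).
    by apply: (near_open openU Uv) => w Uw; rewrite E.
  exact: smooth_on_diff (smooth_on_entry openU i j (sx a)) Uv.
have cse a b : {for u, continuous ('D_a ('D_b (fun u => A u i j)))}.
  apply: differentiable_continuous.
  apply: (@near_eq_differentiable _ _ _ (fun u => 'D_a ('D_b A) u i j)).
    by apply: (near_open openU Uu) => w Uw; rewrite E2.
  exact: smooth_on_diff (smooth_on_entry openU i j (sxx a b)) Uu.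
apply: (deriveC openU) => //.
- by move=> v Uv; exact: smooth_on_diff se Uv.
- by move=> v Uv; exact: dse.
- by move=> v Uv; exact: dse.
Qed.

(** A scalar function is a 1 x 1 matrix. *)
Lemma smooth_on_deriveC_scalar (f : 'rV[R]_n -> R) x y u :
  smooth_on U f -> U u -> 'D_x ('D_y f) u = 'D_y ('D_x f) u.
Proof.
move=> fs Uu; pose A v : 'M[R]_1 := (f v)%:M.
have As : smooth_on U A.
  apply: (smooth_on_mx openU) => i j; rewrite !ord1.
  by apply: (eq_smooth_on openU _ fs) => v _; rewrite mxE.
have D a v : U v -> 'D_a A v 0 0 = 'D_a f v.
  move=> Uv; rewrite -derive_entry; last exact: smooth_on_diff As Uv.
  by congr ('D_a _ v); apply/funext => w; rewrite mxE.
have H := congr1 (fun M : 'M[R]_1 => M 0 0) (smooth_on_deriveC x y As Uu).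
have D2 a b : 'D_a ('D_b A) u 0 0 = 'D_a ('D_b f) u.
  rewrite -derive_entry; last exact: smooth_on_diff (smooth_on_derive openU _ As) Uu.
  by apply: near_eq_derive; apply: (near_open openU Uu) => w Uw; rewrite D.
exact: etrans (esym (D2 x y)) (etrans H (D2 y x)).
Qed.

End SmoothSchwarz.

(** * Levi-Civita connection and curvature in a chart *)

Section PairingTheory.
Context {R : realType} {n : nat} (G : 'M[R]_n).
Implicit Types x y z : 'rV[R]_n.

Lemma pairingDl x y z : pairing G (x + y) z = pairing G x z + pairing G y z.
Proof. by rewrite /pairing !mulmxDl mxE. Qed.
Lemma pairingDr x y z : pairing G x (y + z) = pairing G x y + pairing G x z.
Proof. by rewrite /pairing linearD /= mulmxDr mxE. Qed.
Lemma pairingZl a x y : pairing G (a *: x) y = a * pairing G x y.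
Proof. by rewrite /pairing -!scalemxAl mxE. Qed.
Lemma pairingZr a x y : pairing G x (a *: y) = a * pairing G x y.
Proof. by rewrite /pairing linearZ /= -scalemxAr mxE. Qed.
Lemma pairingNl x y : pairing G (- x) y = - pairing G x y.
Proof. by rewrite /pairing !mulNmx mxE. Qed.
Lemma pairingNr x y : pairing G x (- y) = - pairing G x y.
Proof. by rewrite /pairing linearN /= mulmxN mxE. Qed.
Lemma pairingBl x y z : pairing G (x - y) z = pairing G x z - pairing G y z.
Proof. by rewrite pairingDl pairingNl. Qed.
Lemma pairingBr x y z : pairing G x (y - z) = pairing G x y - pairing G x z.
Proof. by rewrite pairingDr pairingNr. Qed.
Lemma pairing0l x : pairing G 0 x = 0.
Proof. by rewrite /pairing !mul0mx mxE. Qed.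
Lemma pairingC x y : G^T = G -> pairing G x y = pairing G y x.
Proof.
move=> GT; have <- : (x *m G *m y^T)^T 0 0 = pairing G x y by rewrite mxE.
by rewrite !trmx_mul trmxK GT mulmxA.
Qed.
End PairingTheory.

Section MatrixDerivative.
Context {R : realType} {n : nat}.
Implicit Types (u v : 'rV[R]_n).

Lemma derive_mulmx m k l (A : 'rV[R]_n -> 'M[R]_(m, k))
    (B : 'rV[R]_n -> 'M[R]_(k, l)) u v :
  differentiable A u -> differentiable B u ->
  'D_v (fun u => A u *m B u) u = 'D_v A u *m B u + A u *m 'D_v B u.
Proof.
move=> dA dB; have dAe i j := differentiable_entry i j dA.
have dBe i j := differentiable_entry i j dB.
have E i j : (fun u => (A u *m B u) i j) =
    \sum_s ((fun u => A u i s) * (fun u => B u s j)).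
  by apply/funext => w; rewrite mxE fct_sumE.
have dAB : differentiable (fun u => A u *m B u) u.
  apply: differentiable_mx => i j; rewrite E.
  by apply: differentiable_sum => s; exact: differentiableM.
apply/matrixP => i j; rewrite -derive_entry// E derive_sum; last first.
  by move=> s; apply/diff_derivable/differentiableM.
rewrite !mxE -big_split /=; apply: eq_bigr => s _.
rewrite deriveM; try exact: diff_derivable.
by rewrite !derive_entry// addrC; congr (_ + _); exact: mulrC.
Qed.

Lemma derive_trmx m k (A : 'rV[R]_n -> 'M[R]_(m, k)) u v :
  differentiable A u -> 'D_v (fun u => (A u)^T) u = ('D_v A u)^T.
Proof.
move=> dA; have E i j : (fun u => (A u)^T j i) = (fun u => A u i j).
  by apply/funext => w; rewrite mxE.
have dAT : differentiable (fun u => (A u)^T) u.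
  by apply: differentiable_mx => i j; rewrite E; exact: differentiable_entry.
by apply/matrixP => i j; rewrite -derive_entry// E derive_entry// mxE.
Qed.

Lemma derive_scalemx m k (f : 'rV[R]_n -> R) (A : 'rV[R]_n -> 'M[R]_(m, k)) u v :
  differentiable f u -> differentiable A u ->
  'D_v (fun u => f u *: A u) u = 'D_v f u *: A u + f u *: 'D_v A u.
Proof.
move=> df dA; have E i j : (fun u => (f u *: A u) i j) = f * (fun u => A u i j).
  by apply/funext => w; rewrite mxE.
have dfA : differentiable (fun u => f u *: A u) u.
  apply: differentiable_mx => i j; rewrite E; apply: differentiableM => //.
  exact: differentiable_entry.
apply/matrixP => i j; rewrite -derive_entry// E deriveM; last 2 first.
- exact: diff_derivable.
- exact/diff_derivable/differentiable_entry.
by rewrite derive_entry// !mxE addrC; congr (_ + _); exact: mulrC.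
Qed.

End MatrixDerivative.

Section LeviCivita.
Context {R : realType} {n : nat} (U : set 'rV[R]_n) (G : 'rV[R]_n -> 'M[R]_n).
Hypothesis openU : open U.
Hypothesis Gsmooth : smooth_on U G.
Hypothesis Gsym : forall u, U u -> (G u)^T = G u.
Hypothesis Gunit : forall u, U u -> G u \in unitmx.
Implicit Types (u x y z w : 'rV[R]_n) (X Y Z : 'rV[R]_n -> 'rV[R]_n).

Local Notation "'∇_' x Y" := (nabla G (cst x) Y)
  (at level 10, x at next level, Y at next level).
Local Notation sdiff := (smooth_on_diff).

(** The connection matrix of the constant field x: for row vectors the
covariant derivative in the direction x is 'D_x followed by right
multiplication by gamma x (nabla_cstE), so the calculus becomes that of
matrices. *)
Definition gamma x u : 'M[R]_n :=
  \matrix_(j, k) \sum_i x 0 i * christoffel G u i j k.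

(** Christoffel symbols of the first kind, which involve no inverse matrix. *)
Definition gamma_low x u : 'M[R]_n :=
  \matrix_(j, l) \sum_i x 0 i * (2^-1 * (pderiv i (fun u' => G u' j l) u
    + pderiv j (fun u' => G u' i l) u - pderiv l (fun u' => G u' i j) u)).

Lemma gamma_lowE x u : gamma x u = gamma_low x u *m (invmx (G u))^T.
Proof.
apply/matrixP => j k; rewrite !mxE.
under [RHS]eq_bigr do rewrite !mxE mulr_suml.
rewrite exchange_big /=; apply: eq_bigr => i _.
rewrite /christoffel !mulr_sumr; apply: eq_bigr => l _.
by rewrite -!mulrA; congr (_ * (_ * _)); rewrite mulrC.
Qed.

Lemma gamma_mulG x u : U u -> gamma x u *m G u = gamma_low x u.
Proof.
move=> Uu; rewrite gamma_lowE -mulmxA -{2}(Gsym Uu) -trmx_mul.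
by rewrite mulmxV ?Gunit// trmx1 mulmx1.
Qed.

Lemma nabla_at X Y u : nabla G X Y u = (∇_(X u) Y) u.
Proof. by []. Qed.

Lemma nabla_cstE x Y u : (∇_x Y) u = 'D_x Y u + Y u *m gamma x u.
Proof.
rewrite /nabla; congr (_ + _); apply/rowP => k; rewrite !mxE exchange_big /=.
apply: eq_bigr => j _; rewrite mxE mulr_sumr; apply: eq_bigr => i _.
by rewrite mulrA [Y u 0 j * _]mulrC.
Qed.

Lemma smooth_christoffel i j k : smooth_on U (fun u => christoffel G u i j k).
Proof.
apply: smooth_onM => //; first exact: smooth_on_cst.
apply: smooth_on_sum => // l _; apply: smooth_onM => //.
  by apply: smooth_on_entry => //; exact: smooth_on_invmx.
have sp a b c : smooth_on U (pderiv a (fun u' => G u' b c)).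
  by apply: smooth_on_pderiv; exact: smooth_on_entry.
apply: smooth_onD => //; first exact: smooth_onD.
apply: (eq_smooth_on openU
  (f := fun u => -1 * pderiv l (fun u' => G u' i j) u)).
  by move=> u _; rewrite mulN1r.
by apply: smooth_onM => //; exact: smooth_on_cst.
Qed.

Lemma smooth_gamma x : smooth_on U (gamma x).
Proof.
apply: smooth_on_mx => // j k.
apply: (eq_smooth_on openU (f := fun u => \sum_i x 0 i * christoffel G u i j k)).
  by move=> u _; rewrite mxE.
apply: smooth_on_sum => // i _; apply: smooth_onM => //; first exact: smooth_on_cst.
exact: smooth_christoffel.
Qed.

Lemma smooth_nabla x Y : smooth_on U Y -> smooth_on U (∇_x Y).
Proof.
move=> Ys.
apply: (eq_smooth_on openU (f := fun u => 'D_x Y u + Y u *m gamma x u)).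
  by move=> u _; rewrite nabla_cstE.
apply: smooth_on_addmx => //; first exact: smooth_on_derive.
by apply: smooth_on_mulmx => //; exact: smooth_gamma.
Qed.

Lemma eq_nabla x Y Z u : (forall v, U v -> Y v = Z v) -> U u ->
  (∇_x Y) u = (∇_x Z) u.
Proof.
move=> YZ Uu; rewrite !nabla_cstE; congr (_ + _); last by rewrite YZ.
by apply: near_eq_derive; exact: near_open YZ.
Qed.

Lemma nablaD x Y Z u : smooth_on U Y -> smooth_on U Z -> U u ->
  (∇_x (fun v => Y v + Z v)) u = (∇_x Y) u + (∇_x Z) u.
Proof.
move=> Ys Zs Uu; rewrite !nabla_cstE.
rewrite (@deriveD _ _ _ Y Z).
- by rewrite mulmxDl addrACA.
- exact: smooth_on_derivable Ys Uu.
- exact: smooth_on_derivable Zs Uu.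
Qed.

Lemma nablaZ x (f : 'rV[R]_n -> R) Y u : smooth_on U f -> smooth_on U Y -> U u ->
  (∇_x (fun v => f v *: Y v)) u = 'D_x f u *: Y u + f u *: (∇_x Y) u.
Proof.
move=> fs Ys Uu; rewrite !nabla_cstE derive_scalemx.
- by rewrite scalerDr scalemxAl addrA.
- exact: sdiff fs Uu.
- exact: sdiff Ys Uu.
Qed.

Lemma nabla_torsion x y u : U u -> (∇_x (cst y)) u = (∇_y (cst x)) u.
Proof.
move=> Uu; rewrite !nabla_cstE !derive_cst !add0r !gamma_lowE !mulmxA.
congr (_ *m _); apply/rowP => l; rewrite !mxE.
under eq_bigr do rewrite mxE mulr_sumr.
under [RHS]eq_bigr do rewrite mxE mulr_sumr.
rewrite exchange_big /=; apply: eq_bigr => i _; apply: eq_bigr => j _.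
have -> : pderiv l (fun u' => G u' i j) u = pderiv l (fun u' => G u' j i) u.
  apply: near_eq_derive; apply: near_open openU _ _ Uu _ => v Uv.
  by rewrite -[in LHS]Gsym// mxE.
by ring.
Qed.

(** Metric compatibility.  In gamma_low + gamma_low^T all terms cancel except
the derivative of G in the direction x. *)
Lemma derive_metric x u : U u ->
  'D_x G u = gamma x u *m G u + G u *m (gamma x u)^T.
Proof.
move=> Uu; rewrite -{2}(Gsym Uu) -trmx_mul gamma_mulG//.
have dG := sdiff Gsmooth Uu.
rewrite derive_sum_pderiv//; apply/matrixP => j l; rewrite summxE !mxE -big_split.
apply: eq_bigr => i _; rewrite mxE /pderiv -!derive_entry//=.
have -> : 'D_(delta_mx 0 i) (fun v => G v l j) u =
          'D_(delta_mx 0 i) (fun v => G v j l) u.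
  apply: near_eq_derive; apply: near_open openU _ _ Uu _ => v Uv.
  by rewrite -[in LHS]Gsym// mxE.
by field.
Qed.

Lemma smooth_pairing Y Z : smooth_on U Y -> smooth_on U Z ->
  smooth_on U (fun u => pairing (G u) (Y u) (Z u)).
Proof.
move=> Ys Zs; apply: (smooth_on_entry openU).
apply: smooth_on_mulmx => //; first exact: smooth_on_mulmx.
exact: smooth_on_trmx.
Qed.

Lemma derive_pairing x Y Z u : smooth_on U Y -> smooth_on U Z -> U u ->
  'D_x (fun v => pairing (G v) (Y v) (Z v)) u =
  pairing (G u) ((∇_x Y) u) (Z u) + pairing (G u) (Y u) ((∇_x Z) u).
Proof.
move=> Ys Zs Uu.
have dY := sdiff Ys Uu; have dZ := sdiff Zs Uu; have dG := sdiff Gsmooth Uu.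
have YGs := smooth_on_mulmx openU Ys Gsmooth.
have dYG := sdiff YGs Uu; have dZT := sdiff (smooth_on_trmx openU Zs) Uu.
have dYGZ := sdiff (smooth_on_mulmx openU YGs (smooth_on_trmx openU Zs)) Uu.
rewrite /pairing derive_entry// derive_mulmx// derive_mulmx// derive_trmx//.
rewrite derive_metric// !nabla_cstE.
have addE (P Q : 'M[R]_1) : P 0 0 + Q 0 0 = (P + Q) 0 0 by rewrite mxE.
rewrite addE; congr (fun M : 'M[R]_1 => M 0 0).
rewrite [(_ + Z u *m _)^T]linearD /= trmx_mul !mulmxDl !mulmxDr !mulmxDl !mulmxA.
by rewrite !addrA [LHS]addrAC.
Qed.

Definition curv_mx x y u : 'M[R]_n :=
  'D_x (gamma y) u - 'D_y (gamma x) u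
  + (gamma y u *m gamma x u - gamma x u *m gamma y u).

(** Tensoriality: the second derivatives of Z cancel by symmetry, and what
remains depends on Z only through its value at u.  This is why the curvature,
defined with constant extensions, may be computed with gradient fields. *)
Lemma nabla_comm x y Z u : smooth_on U Z -> U u ->
  (∇_x (∇_y Z)) u - (∇_y (∇_x Z)) u = Z u *m curv_mx x y u.
Proof.
move=> Zs Uu.
have E a b : (∇_a (∇_b Z)) u = 'D_a ('D_b Z) u
    + ('D_a Z u *m gamma b u + 'D_b Z u *m gamma a u)
    + Z u *m ('D_a (gamma b) u + gamma b u *m gamma a u).
  have Zg := smooth_on_mulmx openU Zs (smooth_gamma b).
  have dZ := sdiff (smooth_on_derive openU b Zs) Uu.
  rewrite nabla_cstE nabla_cstE.
  have -> : ∇_b Z = 'D_b Z + (fun v => Z v *m gamma b v).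
    by apply/funext => v; rewrite nabla_cstE.
  rewrite deriveD; [|exact: diff_derivable|exact: smooth_on_derivable Zg Uu].
  rewrite derive_mulmx; [|exact: sdiff Zs Uu|exact: sdiff (smooth_gamma b) Uu].
  rewrite mulmxDl mulmxDr !mulmxA !addrA; congr (_ + _).
  by rewrite -!addrA; congr (_ + (_ + _)); rewrite addrC.
rewrite !E (smooth_on_deriveC openU x y Zs Uu).
rewrite ['D_x Z u *m _ + _]addrC opprD [LHS]addrACA subrr add0r.
rewrite -mulmxBr; congr (_ *m _); rewrite /curv_mx opprD.
by rewrite addrACA.
Qed.

Lemma curv_mxC x y u : curv_mx x y u = - curv_mx y x u.
Proof. by rewrite /curv_mx opprD !opprB. Qed.

Lemma curvature_opE x y z u : U u ->
  curvature_op G (cst x) (cst y) (cst z) u = z *m curv_mx x y u.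
Proof.
move=> Uu; rewrite /curvature_op.
have -> : nabla G (bracket (cst x) (cst y)) (cst z) u = 0.
  rewrite nabla_at /bracket !derive_cst subrr nabla_cstE derive0 add0r.
  have -> : gamma 0 u = 0.
    by apply/matrixP => i j; rewrite !mxE big1// => k _; rewrite mxE mul0r.
  by rewrite mulmx0.
by rewrite subr0 (@nabla_comm _ _ (cst z))//; exact: smooth_on_cst.
Qed.

Lemma curvatureE x y z w u : U u ->
  curvature G u x y z w = pairing (G u) (z *m curv_mx x y u) w.
Proof. by move=> Uu; rewrite /curvature curvature_opE. Qed.

(** The antisymmetrised second covariant derivative of g(z, w) vanishes, since
g(z, w) is a function. *)
Lemma curv_mx_skew x y z w u : U u ->
  pairing (G u) (z *m curv_mx x y u) w + pairing (G u) z (w *m curv_mx x y u) = 0.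
Proof.
move=> Uu; have zs := smooth_on_cst openU z; have ws := smooth_on_cst openU w.
have sp := smooth_pairing zs ws.
have E a b : 'D_a ('D_b (fun v => pairing (G v) (cst z v) (cst w v))) u =
   pairing (G u) ((∇_a (∇_b (cst z))) u) w
   + pairing (G u) ((∇_b (cst z)) u) ((∇_a (cst w)) u)
   + (pairing (G u) ((∇_a (cst z)) u) ((∇_b (cst w)) u)
      + pairing (G u) z ((∇_a (∇_b (cst w))) u)).
  rewrite -(derive_pairing a (smooth_nabla b zs) ws Uu).
  rewrite -(derive_pairing a zs (smooth_nabla b ws) Uu).
  rewrite -deriveD; last 2 first.
  - by apply: smooth_on_derivable Uu; apply: smooth_pairing => //; exact: smooth_nabla.
  - by apply: smooth_on_derivable Uu; apply: smooth_pairing => //; exact: smooth_nabla.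
  apply: near_eq_derive; apply: near_open openU _ _ Uu _ => v Uv.
  by rewrite derive_pairing.
have := smooth_on_deriveC_scalar openU x y sp Uu; rewrite !E.
rewrite -(nabla_comm x y zs Uu) -(nabla_comm x y ws Uu) pairingBl pairingBr.
by move=> H; apply/eqP; lra.
Qed.

(** For constant fields, the torsion identity nabla_x y = nabla_y x makes the
six second derivatives cancel in pairs. *)
Lemma curv_mx_bianchi x y z u : U u ->
  z *m curv_mx x y u + x *m curv_mx y z u + y *m curv_mx z x u = 0.
Proof.
move=> Uu; have cs (a : 'rV[R]_n) : smooth_on U (cst a) by exact: smooth_on_cst.
rewrite -(nabla_comm x y (cs z) Uu) -(nabla_comm y z (cs x) Uu).
rewrite -(nabla_comm z x (cs y) Uu).
have E a b c : (∇_a (∇_b (cst c))) u = (∇_a (∇_c (cst b))) u.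
  by apply: eq_nabla => // v Uv; exact: nabla_torsion.
rewrite (E x y z) (E y x z) (E z y x).
move: ((∇_x (∇_z (cst y))) u) ((∇_y (∇_z (cst x))) u) ((∇_z (∇_x (cst y))) u).
by move=> A B C; apply/matrixP => i j; rewrite !mxE; ring.
Qed.

Section Parallel.
Variable J : 'rV[R]_n -> 'M[R]_n.
Hypothesis Jsmooth : smooth_on U J.
Hypothesis Jpar : parallel_on G U J.

Lemma nabla_J x Y u : smooth_on U Y -> U u ->
  (∇_x (fun v => Y v *m J v)) u = (∇_x Y) u *m J u.
Proof. by move=> Ys Uu; apply: Jpar => //; exact: smooth_on_cst. Qed.

Lemma curv_mx_J x y z u : U u ->
  z *m J u *m curv_mx x y u = z *m curv_mx x y u *m J u.
Proof.
move=> Uu; have zs := smooth_on_cst openU z.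
have zJs := smooth_on_mulmx openU zs Jsmooth.
rewrite -(nabla_comm x y zJs Uu) -(nabla_comm x y zs Uu) mulmxBl.
have E a b : (∇_a (∇_b (fun v => cst z v *m J v))) u = (∇_a (∇_b (cst z))) u *m J u.
  rewrite -nabla_J//; last exact: smooth_nabla.
  by apply: eq_nabla => // v Uv; rewrite nabla_J.
by congr (_ - _); exact: E.
Qed.

End Parallel.

End LeviCivita.

(** * Hermitian linear algebra in an orthogonal frame a, Ja, b, Jb *)

Section Hermitian.
Context {R : realType} {n : nat} (G J : 'M[R]_n).
Hypothesis Gsym : G^T = G.
Hypothesis Gpos : forall v, v != 0 -> 0 < pairing G v v.
Hypothesis J2 : J *m J = - 1%:M.
Hypothesis Jherm : forall v w, pairing G (v *m J) (w *m J) = pairing G v w.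
Implicit Types x y v w : 'rV[R]_n.

Lemma pairing_nondegenerate x : (forall v, pairing G x v = 0) -> x = 0.
Proof.
by move=> x0; apply/eqP/negP => /negP /Gpos; rewrite x0 ltxx.
Qed.

Lemma pairing_unitmx : G \in unitmx.
Proof.
rewrite -row_free_unit -kermx_eq0; apply/eqP/row_matrixP => i; rewrite row0.
apply: pairing_nondegenerate => v.
by rewrite /pairing -row_mul mulmx_ker row0 mul0mx mxE.
Qed.

Lemma mulmxJJ x : x *m J *m J = - x.
Proof. by rewrite -mulmxA J2 mulmxN mulmx1. Qed.

Lemma pairing_Jl x y : pairing G (x *m J) y = - pairing G x (y *m J).
Proof. by rewrite -[in RHS]Jherm mulmxJJ pairingNr opprK. Qed.

Lemma pairing_J0 x : pairing G x (x *m J) = 0.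
Proof. by have := pairing_Jl x x; rewrite pairingC// => H; lra. Qed.

End Hermitian.

Section Frame.
Context {R : realType} (G J : 'M[R]_4).
Hypothesis Gsym : G^T = G.
Hypothesis Gpos : forall v, v != 0 -> 0 < pairing G v v.
Hypothesis J2 : J *m J = - 1%:M.
Hypothesis Jherm : forall v w, pairing G (v *m J) (w *m J) = pairing G v w.
Variables a b : 'rV[R]_4.
Hypothesis ab : pairing G a b = 0.
Hypothesis aJb : pairing G (a *m J) b = 0.
Hypothesis a0 : a != 0.
Hypothesis b0 : b != 0.
Implicit Types x y v w : 'rV[R]_4.

Local Notation g := (pairing G).
Local Notation alpha := (pairing G a a).
Local Notation beta := (pairing G b b).
Let gC x y : g x y = g y x. Proof. exact: pairingC. Qed.
Let gJl := pairing_Jl J2 Jherm.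

Let abJ : g a (b *m J) = 0.
Proof. by rewrite -[LHS]opprK -gJl aJb oppr0. Qed.

Let frameE := (ab, aJb, abJ, gC b a, gC b (a *m J), gC (b *m J) a,
  gC (a *m J) a, gC (b *m J) b, pairing_J0 Gsym J2 Jherm, Jherm,
  gC (b *m J) (a *m J)).

(** Four nonzero orthogonal vectors in dimension four form a basis. *)
Lemma frame_expand x :
  x = (g x a / alpha) *: a + (g x (a *m J) / alpha) *: (a *m J)
      + (g x b / beta) *: b + (g x (b *m J) / beta) *: (b *m J).
Proof.
have al0 : alpha != 0 by rewrite gt_eqF// Gpos.
have be0 : beta != 0 by rewrite gt_eqF// Gpos.
pose e (i : 'I_4) := nth 0 [:: a; a *m J; b; b *m J] i.
pose E : 'M[R]_4 := \matrix_(i, j) e i 0 j.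
pose d : 'rV[R]_4 := \row_i nth 0 [:: alpha; alpha; beta; beta] i.
have rE i : row i E = e i by apply/rowP => j; rewrite !mxE.
(* The Gram matrix of the frame is diagonal and invertible. *)
have EE : E *m G *m E^T = diag_mx d.
  apply/matrixP => i j; have -> : (E *m G *m E^T) i j = g (e i) (e j).
    rewrite /pairing -!rE !rowE trmx_mul trmx_delta !mulmxA.
    by rewrite -colE -!mulmxA -rowE !mxE.
  rewrite !mxE; case: i => [[|[|[|[|//]]]] ?]; case: j => [[|[|[|[|//]]]] ?];
    rewrite /e /= ?mulr1n ?mulr0n ?Jherm ?(gC b) ?(gC (_ *m _) a)
      ?(gC (b *m J) (a *m J)) ?Jherm ?pairing_J0 // gC pairing_J0 //.
have Eu : E \in unitmx.
  suff : E *m (G *m E^T) \in unitmx by rewrite unitmx_mul => /andP[].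
  rewrite mulmxA EE unitmxE det_diag unitfE !big_ord_recl big_ord0 !mxE /= mulr1.
  by rewrite !mulf_neq0.
set y := _ + _; apply/eqP; rewrite -subr_eq0; apply/eqP.
have yE i : g (e i) (x - y) = 0.
  case: i => [[|[|[|[|//]]]] ?]; rewrite /e /= pairingBr /y !pairingDr !pairingZr;
    rewrite ?Jherm ?(gC b a) ?(gC (b *m J) a) ?(gC b (a *m J))
      ?(gC (b *m J) (a *m J)) ?Jherm ?(gC (_ *m _) a) ?(gC (_ *m _) b)
      ?pairing_J0// ?ab ?aJb ?abJ ?(gC b (a *m J)) ?aJb ?mulr0 ?addr0 ?add0r
      ?divfK// (gC x) subrr//.
have : E *m (G *m (x - y)^T) = 0.
  apply/matrixP => i j; rewrite ord1 [RHS]mxE -(yE i) /pairing -rE rowE.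
  by rewrite -!mulmxA -rowE [RHS]mxE.
move=> /(congr1 (mulmx (invmx E))); rewrite mulKmx// mulmx0 => Gxy.
apply: (pairing_nondegenerate Gpos) => v.
by rewrite gC /pairing -mulmxA Gxy mulmx0 mxE.
Qed.

Lemma parseval x y : g x y =
  (g x a * g y a + g x (a *m J) * g y (a *m J)) / alpha +
  (g x b * g y b + g x (b *m J) * g y (b *m J)) / beta.
Proof.
rewrite {1}(frame_expand x) !pairingDl !pairingZl !(gC _ y).
by ring.
Qed.

Section Hessians.
(** P and Q stand for the covariant Hessians of xi and eta at a point, and a, b
for their gradients; T is the Hessian of xi * eta.  The hypotheses with J say
that J grad (xi + eta) and J grad (xi * eta) are Killing, and the last two are
the derivatives of g a b = 0 and g (J a) b = 0. *)
Variables (P Q : 'rV[R]_4 -> 'rV[R]_4) (xi eta : R).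
Hypothesis xieta : xi != eta.
Hypothesis Psym : forall x y, g (P x) y = g (P y) x.
Hypothesis Qsym : forall x y, g (Q x) y = g (Q y) x.
Hypothesis PQ_J : forall x y,
  g ((P x + Q x) *m J) y + g x ((P y + Q y) *m J) = 0.
Let T x := g a x *: b + xi *: Q x + (g b x *: a + eta *: P x).
Hypothesis T_J : forall x y, g (T x *m J) y + g x (T y *m J) = 0.
Hypothesis Pb_Qa : forall x, g (P x) b + g a (Q x) = 0.
Hypothesis PJb_Qa : forall x, g (P x *m J) b + g (a *m J) (Q x) = 0.

Let d := (2 * (xi - eta))^-1.
Let p := g (P a) a / alpha.
Let q := g (Q b) b / beta.

(** Since T = xi (P + Q) - (xi - eta) P plus the symmetric product of a and b,
and since T and P + Q commute with J, the J-anti-invariant part of P is that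
of the symmetric product of a and b, divided by xi - eta. *)
Let P_anti x y : (xi - eta) * (g (P x) (y *m J) + g (P y) (x *m J)) =
  - (g x a * g y (b *m J) + g x b * g y (a *m J))
  - (g y a * g x (b *m J) + g y b * g x (a *m J)).
Proof.
have E1 := PQ_J x y; have E2 := T_J x y; rewrite /T in E2.
rewrite !mulmxDl !pairingDl !pairingDr !gJl !(gC x (_ *m J)) !gJl in E1.
rewrite !mulmxDl -!scalemxAl !(pairingDl, pairingDr, pairingZl, pairingZr) in E2.
rewrite !gJl !(gC x (_ *m J)) !gJl !(gC a) !(gC b) !gJl in E2.
by move: E1 => /(congr1 ( *%R xi)) E1; lra.
Qed.

Let Q_anti x y : (xi - eta) * (g (Q x) (y *m J) + g (Q y) (x *m J)) =
  (g x a * g y (b *m J) + g x b * g y (a *m J))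
  + (g y a * g x (b *m J) + g y b * g x (a *m J)).
Proof.
have := PQ_J x y; have := P_anti x y.
rewrite !mulmxDl !(pairingDl, pairingDr) !gJl !(gC x (_ *m J)) !gJl.
by move=> E1 /(congr1 ( *%R (xi - eta))) E2; lra.
Qed.

Let D0 : xi - eta != 0. Proof. by rewrite subr_eq0. Qed.
Let aa0 : alpha != 0. Proof. by rewrite gt_eqF// Gpos. Qed.
Let bb0 : beta != 0. Proof. by rewrite gt_eqF// Gpos. Qed.
Let d0 : 2 * (xi - eta) != 0. Proof. by rewrite mulf_neq0// pnatr_eq0. Qed.

Let mulmxJ2 := mulmxJJ J2.

Lemma hessian_Qa x : g (Q x) a = - g (P x) b.
Proof. by have := Pb_Qa x; rewrite (gC a) => H; lra. Qed.

Lemma hessian_QaJ x : g (Q x) (a *m J) = g (P x) (b *m J).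
Proof. by have := PJb_Qa x; rewrite gJl (gC (a *m J)) => H; lra. Qed.

(** P_anti at b gives the sum of g (P x) (J b) and g (P b) (J x); Q_anti at a,
rewritten with the two orthogonality relations, gives their difference. *)
Lemma hessian_PbJ_PJb x :
  2 * (xi - eta) * g (P x) (b *m J) =
    alpha * g x (b *m J) - beta * g x (a *m J) /\
  2 * (xi - eta) * g (P b) (x *m J) =
    - (alpha * g x (b *m J) + beta * g x (a *m J)).
Proof.
have := P_anti x b; have := Q_anti x a; rewrite !frameE hessian_QaJ.
rewrite [g (Q a) _]Qsym hessian_Qa [g (P (x *m J)) b]Psym.
by move=> E1 E2; split; lra.
Qed.

Lemma hessian_PbJ x : 2 * (xi - eta) * g (P x) (b *m J) =
  alpha * g x (b *m J) - beta * g x (a *m J).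
Proof. by have [] := hessian_PbJ_PJb x. Qed.

Lemma hessian_Pb x : 2 * (xi - eta) * g (P x) b =
  alpha * g x b + beta * g x a.
Proof.
have [_] := hessian_PbJ_PJb (x *m J).
rewrite mulmxJ2 pairingNr Psym !Jherm => H; lra.
Qed.

Lemma hessian_Pa x : g (P x) a = p * g x a + alpha * d * g x b.
Proof.
rewrite Psym (parseval (P a) x).
have e1 : g (P a) (a *m J) = 0.
  by apply: (mulfI D0); have := P_anti a a; rewrite !frameE => H; lra.
have e2 : g (P a) b = alpha * beta * d.
  by apply: (mulfI d0); rewrite hessian_Pb !frameE /d; field.
have e3 : g (P a) (b *m J) = 0.
  by apply: (mulfI d0); rewrite hessian_PbJ !frameE; lra.
by rewrite e1 e2 e3 /p; field; rewrite aa0 bb0.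
Qed.

Lemma hessian_PaJ x : g (P x) (a *m J) = p * g x (a *m J) - alpha * d * g x (b *m J).
Proof.
rewrite Psym (parseval (P _) x).
have e1 : g (P (a *m J)) a = 0.
  by rewrite Psym; apply: (mulfI D0); have := P_anti a a; rewrite !frameE => H; lra.
have e0 : g (P (a *m J)) (a *m J) = g (P a) a.
  apply: (mulfI D0); have := P_anti a (a *m J).
  by rewrite mulmxJ2 !frameE pairingNr => H; lra.
have e2 : g (P (a *m J)) b = 0.
  by apply: (mulfI d0); rewrite hessian_Pb !frameE; lra.
have e3 : g (P (a *m J)) (b *m J) = - (alpha * beta * d).
  by apply: (mulfI d0); rewrite hessian_PbJ !frameE /d; field.
by rewrite e0 e1 e2 e3 /p; field; rewrite aa0 bb0.
Qed.

Lemma hessian_Qb x : g (Q x) b = q * g x b - beta * d * g x a.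
Proof.
rewrite Qsym (parseval (Q b) x).
have e1 : g (Q b) (b *m J) = 0.
  by apply: (mulfI D0); have := Q_anti b b; rewrite !frameE => H; lra.
have e2 : g (Q b) a = - (alpha * beta * d).
  by rewrite hessian_Qa; apply: (mulfI d0); rewrite mulrN hessian_Pb !frameE /d; field.
have e3 : g (Q b) (a *m J) = 0.
  by rewrite hessian_QaJ; apply: (mulfI d0); rewrite hessian_PbJ !frameE; lra.
by rewrite e1 e2 e3 /q; field; rewrite aa0 bb0.
Qed.

Lemma hessian_QbJ x : g (Q x) (b *m J) = q * g x (b *m J) + beta * d * g x (a *m J).
Proof.
rewrite Qsym (parseval (Q _) x).
have e1 : g (Q (b *m J)) b = 0.
  by rewrite Qsym; apply: (mulfI D0); have := Q_anti b b; rewrite !frameE => H; lra.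
have e0 : g (Q (b *m J)) (b *m J) = g (Q b) b.
  apply: (mulfI D0); have := Q_anti b (b *m J).
  by rewrite mulmxJ2 !frameE pairingNr => H; lra.
have e2 : g (Q (b *m J)) a = 0.
  by rewrite hessian_Qa; apply: (mulfI d0); rewrite mulrN hessian_Pb !frameE; lra.
have e3 : g (Q (b *m J)) (a *m J) = alpha * beta * d.
  by rewrite hessian_QaJ; apply: (mulfI d0); rewrite hessian_PbJ !frameE /d; field.
by rewrite e0 e1 e2 e3 /q; field; rewrite aa0 bb0.
Qed.

(** This is (s - t) / (2 (xi - eta)), where s = p - |b|^2 d and
t = q + |a|^2 d are the eigenvalues of the Hessian of xi + eta on the complex
lines of a and of b. *)
Definition curvature_coef := (p - q - (alpha + beta) * d) * d.

Let Pb_d x : g (P x) b = d * (alpha * g x b + beta * g x a).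
Proof. by apply: (mulfI d0); rewrite hessian_Pb /d; field. Qed.

Let PbJ_d x : g (P x) (b *m J) = d * (alpha * g x (b *m J) - beta * g x (a *m J)).
Proof. by apply: (mulfI d0); rewrite hessian_PbJ /d; field. Qed.

(** What differentiating 2 (xi - eta) g (P y) b = |a|^2 g y b + |b|^2 g y a in
the direction x leaves, apart from the curvature and from terms symmetric in
x and y by vanishing of the torsion. *)
Let F x y := - 2 * (g x a - g x b) * g (P y) b
  - 2 * (xi - eta) * g (P y) (Q x)
  + 2 * g (P x) a * g y b + alpha * g (Q x) y
  + 2 * g (Q x) b * g y a + beta * g (P x) y.

(** The same for 2 (xi - eta) g (P y) (J b) = |a|^2 g y (J b) - |b|^2 g y (J a). *)
Let FJ x y := - 2 * (g x a - g x b) * g (P y) (b *m J)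
  - 2 * (xi - eta) * g (P y) (Q x *m J)
  + 2 * g (P x) a * g y (b *m J) + alpha * g (Q x *m J) y
  - (2 * g (Q x) b * g y (a *m J) + beta * g (P x *m J) y).

Lemma curvature_ab_of_hessians x y r : 2 * (xi - eta) * r = F x y - F y x ->
  r = curvature_coef *
  (g x a * g y b - g x b * g y a
   + g x (a *m J) * g y (b *m J) - g x (b *m J) * g y (a *m J)).
Proof.
move=> E; apply: (mulfI d0); rewrite E /F (Psym y x) (Qsym y x).
rewrite (parseval (P y) (Q x)) (parseval (P x) (Q y)).
rewrite !hessian_Qa !hessian_QaJ !Pb_d !PbJ_d !hessian_Pa !hessian_PaJ.
rewrite !hessian_Qb !hessian_QbJ /curvature_coef.
by move: (p) (q) => p' q'; rewrite /d; field; rewrite aa0 bb0 D0.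
Qed.

Lemma curvature_abJ_of_hessians x y r : 2 * (xi - eta) * r = FJ x y - FJ y x ->
  r = curvature_coef *
  (g x a * g y (b *m J) - g x (b *m J) * g y a
   - g x (a *m J) * g y b + g x b * g y (a *m J)).
Proof.
move=> E; apply: (mulfI d0); rewrite E /FJ.
rewrite (parseval (P y) (Q x *m J)) (parseval (P x) (Q y *m J)).
rewrite (parseval (Q x *m J) y) (parseval (Q y *m J) x).
rewrite (parseval (P x *m J) y) (parseval (P y *m J) x).
rewrite !Jherm !gJl.
rewrite !hessian_Qa !hessian_QaJ !Pb_d !PbJ_d !hessian_Pa !hessian_PaJ.
rewrite !hessian_Qb !hessian_QbJ /curvature_coef.
by move: (p) (q) => p' q'; rewrite /d; field; rewrite aa0 bb0 D0.
Qed.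

End Hessians.

Section CurvatureAlgebra.

(** Up to the factors |a|^2 and |b|^2, the squared lengths of the orthogonal
projections of x to the complex lines of a and of b. *)
Definition line_normsq x := g x a ^+ 2 + g x (a *m J) ^+ 2.
Definition line_perp_normsq x := g x b ^+ 2 + g x (b *m J) ^+ 2.

(** A skew endomorphism commuting with J is a skew-Hermitian 2 x 2 matrix: it
has two imaginary diagonal entries and one complex off-diagonal entry. *)
Lemma skew_hermitian_form (S : 'M[R]_4) x :
  (forall z w : 'rV[R]_4, g (z *m S) w + g z (w *m S) = 0) ->
  (forall z : 'rV[R]_4, z *m J *m S = z *m S *m J) ->
  g (x *m J *m S) x =
    line_normsq x / alpha ^+ 2 * g (a *m J *m S) a
    + line_perp_normsq x / beta ^+ 2 * g (b *m J *m S) b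
    + 2 / (alpha * beta) *
      (g (a *m S) b * (g x a * g x (b *m J) - g x (a *m J) * g x b)
      - g (a *m S) (b *m J) * (g x a * g x b + g x (a *m J) * g x (b *m J))).
Proof.
move=> Sskew SJ; rewrite /line_normsq /line_perp_normsq.
have aa0 : alpha != 0 by rewrite gt_eqF// Gpos.
have bb0 : beta != 0 by rewrite gt_eqF// Gpos.
have S0 (z : 'rV[R]_4) : g (z *m S) z = 0.
  by have := Sskew z z; rewrite (gC z) => H; lra.
have SC (z w : 'rV[R]_4) : g (z *m S) w = - g (w *m S) z.
  by have := Sskew z w; rewrite (gC z) => H; lra.
have SJJ (z w : 'rV[R]_4) : g (z *m J *m S) (w *m J) = g (z *m S) w.
  by rewrite SJ Jherm.
have SJr (z w : 'rV[R]_4) : g (z *m J *m S) w = - g (z *m S) (w *m J).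
  by rewrite SJ gJl.
rewrite {1 2}(frame_expand x).
move: (g x a) (g x (a *m J)) (g x b) (g x (b *m J)) => x1 x2 x3 x4.
rewrite !mulmxDl -!scalemxAl !(mulmxJJ J2).
rewrite !(pairingDl, pairingDr, pairingZl, pairingZr) !mulNmx !pairingNl !SJJ !S0.
rewrite (SJr a b) (SJr b a) (SC b a) (SC b (a *m J)) (SJr a b).
rewrite -[g (a *m S) (a *m J)]opprK -(SJr a a).
rewrite -[g (b *m S) (b *m J)]opprK -(SJr b b).
by field; rewrite aa0 bb0.
Qed.

Variables (C : 'rV[R]_4 -> 'rV[R]_4 -> 'M[R]_4) (c : R).
Hypothesis C_antisym : forall x y, C x y = - C y x.
Hypothesis C_skew : forall x y (z w : 'rV[R]_4),
  g (z *m C x y) w + g z (w *m C x y) = 0.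
Hypothesis C_bianchi : forall x y z,
  z *m C x y + x *m C y z + y *m C z x = 0.
Hypothesis C_J : forall x y (z : 'rV[R]_4), z *m J *m C x y = z *m C x y *m J.
Hypothesis C_ab : forall x y, g (a *m C x y) b = c *
  (g x a * g y b - g x b * g y a
   + g x (a *m J) * g y (b *m J) - g x (b *m J) * g y (a *m J)).
Hypothesis C_abJ : forall x y, g (a *m C x y) (b *m J) = c *
  (g x a * g y (b *m J) - g x (b *m J) * g y a
   - g x (a *m J) * g y b + g x b * g y (a *m J)).

(** The usual octahedron argument: four instances of the Bianchi identity. *)
Lemma curvature_pair_sym x y z w :
  g (z *m C x y) w = g (x *m C z w) y.
Proof.
have bi p q r s : g (r *m C p q) s + g (p *m C q r) s + g (q *m C r p) s = 0.
  by rewrite -!pairingDl C_bianchi pairing0l.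
have a1 p q r s : g (r *m C p q) s = - g (r *m C q p) s.
  by rewrite C_antisym mulmxN pairingNl.
have a2 p q r s : g (r *m C p q) s = - g (s *m C p q) r.
  by have := C_skew p q r s; rewrite (gC r) => H; lra.
have := bi x y z w; have := bi y z w x; have := bi z w x y; have := bi w x y z.
rewrite (a2 y z w x) (a2 z w y x) (a1 w y) (a1 w x z) (a2 x w z y) (a1 x z w).
rewrite (a2 z x w y) (a1 w x y) (a2 x y w z) (a2 y w x z).
by move=> E1 E2 E3 E4; lra.
Qed.

(** The Hermitian form of C(x, Jx) at x has an off-diagonal contribution, which
C_ab and C_abJ make proportional to the product of the two norms.  By pair
symmetry its diagonal entries are the forms of C(Ja, a) and C(Jb, b) at x, and
C_ab, C_abJ say that these are diagonal in the frame. *)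
Lemma holomorphic_sectional_frame : exists k : R -> R -> R, forall x,
  g (x *m J *m C x (x *m J)) x = k (line_normsq x) (line_perp_normsq x).
Proof.
have Cs x y z := skew_hermitian_form z (C_skew x y) (C_J x y).
exists (fun s t =>
  - (s / alpha ^+ 2 * (s / alpha ^+ 2 * g (a *m J *m C (a *m J) a) a
                     + t / beta ^+ 2 * g (b *m J *m C (a *m J) a) b)
  + t / beta ^+ 2 * (s / alpha ^+ 2 * g (a *m J *m C (b *m J) b) a
                     + t / beta ^+ 2 * g (b *m J *m C (b *m J) b) b))
  - 4 / (alpha * beta) * c * s * t) => x.
rewrite (Cs x (x *m J) x).
have flip y : g (y *m J *m C x (x *m J)) y = - g (x *m J *m C (y *m J) y) x.
  rewrite curvature_pair_sym; have := C_skew (y *m J) y x (x *m J).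
  by rewrite (gC x) => H; lra.
rewrite (flip a) (flip b) (Cs (a *m J) a x) (Cs (b *m J) b x) !C_ab !C_abJ.
have xJa : g (x *m J) a = - g x (a *m J) by rewrite gJl.
have xJb : g (x *m J) b = - g x (b *m J) by rewrite gJl.
rewrite !Jherm xJa xJb !frameE /line_normsq /line_perp_normsq.
ring.
Qed.

End CurvatureAlgebra.
End Frame.

(** * Gradients, Hessians and Killing fields *)

Section Gradient.
Context {R : realType} {n : nat} (U : set 'rV[R]_n) (G : 'rV[R]_n -> 'M[R]_n).
Hypothesis openU : open U.
Hypothesis Gsmooth : smooth_on U G.
Hypothesis Gsym : forall u, U u -> (G u)^T = G u.
Hypothesis Gunit : forall u, U u -> G u \in unitmx.
Implicit Types (u x y z w : 'rV[R]_n) (f : 'rV[R]_n -> R).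

Local Notation "'∇_' x Y" := (nabla G (cst x) Y)
  (at level 10, x at next level, Y at next level).

Definition gradient f u : 'rV[R]_n := (\row_i pderiv i f u) *m invmx (G u).

Lemma smooth_gradient f : smooth_on U f -> smooth_on U (gradient f).
Proof.
move=> fs; apply: (smooth_on_mulmx openU); last exact: smooth_on_invmx.
apply: (smooth_on_mx openU) => i j.
apply: (eq_smooth_on openU (f := pderiv j f)); first by move=> u _; rewrite mxE.
exact: smooth_on_pderiv.
Qed.

Lemma pairing_gradient f u v : smooth_on U f -> U u ->
  pairing (G u) (gradient f u) v = 'D_v f u.
Proof.
move=> fs Uu; rewrite /pairing /gradient mulmxKV ?Gunit//.
rewrite derive_sum_pderiv; last exact: smooth_on_diff fs Uu.
by rewrite mxE; apply: eq_bigr => i _; rewrite !mxE; exact: mulrC.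
Qed.

Lemma pairing_gradients f h u : U u ->
  pairing (G u) (gradient f u) (gradient h u) =
  pairing (invmx (G u)) (\row_i pderiv i f u) (\row_i pderiv i h u).
Proof.
move=> Uu; rewrite /pairing /gradient mulmxKV ?Gunit//.
by rewrite trmx_mul trmx_inv Gsym// mulmxA.
Qed.

(** Vanishing of the torsion and symmetry of the second derivatives of f. *)
Lemma hessian_sym f x y u : smooth_on U f -> U u ->
  pairing (G u) ((∇_x (gradient f)) u) y = pairing (G u) ((∇_y (gradient f)) u) x.
Proof.
move=> fs Uu; have gs := smooth_gradient fs.
have cs (c : 'rV[R]_n) : smooth_on U (cst c) by exact: smooth_on_cst.
have E a b : 'D_a ('D_b f) u = pairing (G u) ((∇_a (gradient f)) u) b
    + pairing (G u) (gradient f u) ((∇_a (cst b)) u).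
  rewrite -(derive_pairing openU Gsmooth Gsym Gunit a gs (cs b) Uu).
  apply: near_eq_derive; apply: (near_open openU Uu) => v Uv.
  by rewrite pairing_gradient.
have := smooth_on_deriveC_scalar openU x y fs Uu.
rewrite !E (nabla_torsion openU Gsym x y Uu).
exact: addIr.
Qed.

(** Killing's equation in covariant form; testing on constant fields suffices,
because vanishing torsion turns brackets into covariant derivatives. *)
Lemma killing_nabla K x y u : smooth_on U K -> killing_on G U K -> U u ->
  pairing (G u) ((∇_x K) u) y + pairing (G u) x ((∇_y K) u) = 0.
Proof.
move=> Ks Kk Uu.
have cs (c : 'rV[R]_n) : smooth_on U (cst c) by exact: smooth_on_cst.
have := Kk _ _ (cs x) (cs y) u Uu.
rewrite /lie_metric (derive_pairing openU Gsmooth Gsym Gunit (K u) (cs x) (cs y) Uu).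
rewrite /bracket (nabla_torsion openU Gsym (K u) x Uu).
rewrite (nabla_torsion openU Gsym (K u) y Uu) !nabla_cstE !derive_cst.
move: ('D_x K u) ('D_y K u) => Kx Ky.
rewrite !sub0r !add0r pairingNl pairingNr !opprK !pairingDl !pairingDr => H.
rewrite -[RHS]H.
move: (pairing _ _ _) (pairing _ _ _) (pairing _ _ _) (pairing _ _ _) => A B C D.
by ring.
Qed.

(** The identity for g (nabla_z a) e holds on all of U, so it can be
differentiated; antisymmetrising in the two directions produces the curvature,
and the terms containing nabla_x y disappear because the torsion vanishes. *)
Lemma curvature_of_hessian_identity (a b e e' : 'rV[R]_n -> 'rV[R]_n)
    (k : 'rV[R]_n -> R) x y u :
  smooth_on U k -> smooth_on U a -> smooth_on U b ->
  smooth_on U e -> smooth_on U e' -> U u ->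
  (forall v z, U v -> k v * pairing (G v) ((∇_z a) v) (e v) =
     pairing (G v) (a v) (a v) * pairing (G v) z (e v) +
     pairing (G v) (b v) (b v) * pairing (G v) z (e' v)) ->
  let g := pairing (G u) in
  let F x y := - 'D_x k u * g ((∇_y a) u) (e u)
    - k u * g ((∇_y a) u) ((∇_x e) u)
    + 2 * g ((∇_x a) u) (a u) * g y (e u) + g (a u) (a u) * g ((∇_x e) u) y
    + 2 * g ((∇_x b) u) (b u) * g y (e' u) + g (b u) (b u) * g ((∇_x e') u) y in
  k u * g (a u *m curv_mx G x y u) (e u) = F x y - F y x.
Proof.
move=> ks as_ bs es es' Uu Hk g F.
have gC v z w : U v -> pairing (G v) z w = pairing (G v) w z.
  by move=> Uv; apply: pairingC; exact: Gsym.
have cs (c : 'rV[R]_n) : smooth_on U (cst c) by exact: smooth_on_cst.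
have sp := smooth_pairing openU Gsmooth.
have sn c Y := @smooth_nabla R n U G openU Gsmooth Gunit c Y.
have LHS c d : 'D_c (fun v => k v * pairing (G v) ((∇_d a) v) (e v)) u =
    'D_c k u * g ((∇_d a) u) (e u)
    + k u * (g ((∇_c (∇_d a)) u) (e u) + g ((∇_d a) u) ((∇_c e) u)).
  rewrite -(derive_pairing openU Gsmooth Gsym Gunit c (sn d a as_) es Uu).
  rewrite (@deriveM _ _ k); last 2 first.
  - exact: smooth_on_derivable ks Uu.
  - exact: smooth_on_derivable (sp _ _ (sn d a as_) es) Uu.
  by rewrite addrC; congr (_ + _); exact: mulrC.
have D2 c (Y Z : 'rV[R]_n -> 'rV[R]_n) d : smooth_on U Y -> smooth_on U Z ->
    'D_c (fun v => pairing (G v) (Y v) (Y v) * pairing (G v) (Z v) d) u =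
    2 * g ((∇_c Y) u) (Y u) * g (Z u) d
    + g (Y u) (Y u) * (g ((∇_c Z) u) d + g (Z u) ((∇_c (cst d)) u)).
  move=> Ys Zs.
  rewrite -(derive_pairing openU Gsmooth Gsym Gunit c Zs (cs d) Uu).
  rewrite (@deriveM _ _ (fun v => pairing (G v) (Y v) (Y v))); last 2 first.
  - exact: smooth_on_derivable (sp _ _ Ys Ys) Uu.
  - exact: smooth_on_derivable (sp _ _ Zs (cs d)) Uu.
  rewrite (derive_pairing openU Gsmooth Gsym Gunit c Ys Ys Uu).
  rewrite (@pairingC _ _ _ (Y u) ((∇_c Y) u))// ?Gsym// addrC -mulr2n.
  by congr (_ + _); rewrite -[_ *+ 2]mulr_natl; exact: mulrC.
have E c d : 'D_c k u * g ((∇_d a) u) (e u)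
    + k u * (g ((∇_c (∇_d a)) u) (e u) + g ((∇_d a) u) ((∇_c e) u)) =
    2 * g ((∇_c a) u) (a u) * g (e u) d
    + g (a u) (a u) * (g ((∇_c e) u) d + g (e u) ((∇_c (cst d)) u))
    + (2 * g ((∇_c b) u) (b u) * g (e' u) d
    + g (b u) (b u) * (g ((∇_c e') u) d + g (e' u) ((∇_c (cst d)) u))).
  rewrite -LHS -(D2 c a e d as_ es) -(D2 c b e' d bs es').
  rewrite -deriveD; last 2 first.
  - apply: smooth_on_derivable Uu.
    exact: (smooth_onM openU (sp _ _ as_ as_) (sp _ _ es (cs d))).
  - apply: smooth_on_derivable Uu.
    exact: (smooth_onM openU (sp _ _ bs bs) (sp _ _ es' (cs d))).
  apply: near_eq_derive; apply: (near_open openU Uu) => v Uv.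
  have H := Hk v d Uv; rewrite (gC v d (e v) Uv) (gC v d (e' v) Uv) in H.
  exact: H.
have := E y x; have := E x y; rewrite {E LHS D2}.
rewrite (nabla_torsion openU Gsym y x Uu).
have -> : g (a u *m curv_mx G x y u) (e u) =
    g ((∇_x (∇_y a)) u) (e u) - g ((∇_y (∇_x a)) u) (e u).
  by rewrite /g -(nabla_comm openU Gsmooth Gunit x y as_ Uu) pairingBl.
rewrite /F /g (gC u y (e u) Uu) (gC u y (e' u) Uu).
rewrite (gC u x (e u) Uu) (gC u x (e' u) Uu).
move: ('D_x k u) ('D_y k u) (k u) => kx ky k0 E1 E2.
lra.
Qed.

End Gradient.

(** * Complex lines and orthotoric data in a chart *)

(** Contradicts independence of K1 and K2 in each degenerate case: if xi = eta,
if grad xi = 0 or if grad eta = 0, then K1 is a multiple of K2. *)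
Lemma rank_proportional_rows (F : fieldType) n (v : 'rV[F]_n) (s : F) :
  (\rank (col_mx (s *: v) v) <= 1)%N.
Proof.
have -> : col_mx (s *: v) v = col_mx s%:M 1%:M *m v.
  by rewrite mul_col_mx !mul_scalar_mx scale1r.
exact: leq_trans (mxrankM_maxr _ _) (rank_leq_row _).
Qed.

(** The square matrix <<_>> is used because a distribution of rank 2 is
given by square matrices whose row spaces are its fibres. *)
Definition complex_line n (R : realType) (v : 'rV[R]_n) (J : 'M[R]_n) :
  'M[R]_n := <<col_mx v (v *m J)>>%MS.

Lemma complex_line_invariant n (R : realType) (v : 'rV[R]_n) (J : 'M[R]_n) :
  J *m J = - 1%:M -> (complex_line v J *m J <= complex_line v J)%MS.
Proof.
move=> J2; rewrite (eqmxMr _ (genmxE _)) genmxE mul_col_mx col_mx_sub (mulmxJJ J2).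
have -> : (v *m J <= col_mx v (v *m J))%MS.
  by rewrite -addsmxE addsmxSr.
by rewrite eqmx_opp -addsmxE addsmxSl.
Qed.

Lemma complex_line_rank n (R : realType) (v : 'rV[R]_n) (G J : 'M[R]_n) :
  G^T = G -> J *m J = - 1%:M ->
  (forall x y, pairing G (x *m J) (y *m J) = pairing G x y) ->
  0 < pairing G v v -> \rank (complex_line v J) = 2.
Proof.
move=> Gsym J2 Jh vpos; rewrite genmxE; apply/eqP.
change (row_free (col_mx v (v *m J))); rewrite -kermx_eq0; apply/rowV0P => w.
move/sub_kermxP; rewrite -[w]hsubmxK mul_row_col.
rewrite [lsubmx w]mx11_scalar [rsubmx w]mx11_scalar !mul_scalar_mx.
move: (lsubmx w 0 0) (rsubmx w 0 0) => p q E.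
have J0 := pairing_J0 Gsym J2 Jh.
have p0 : p = 0.
  have := congr1 (fun x => pairing G x v) E; rewrite pairingDl !pairingZl pairing0l.
  rewrite (pairingC (v *m J))// J0 mulr0 addr0 => /eqP.
  by rewrite mulf_eq0 (gt_eqF vpos) orbF => /eqP.
have q0 : q = 0.
  have := congr1 (fun x => pairing G x (v *m J)) E.
  rewrite pairingDl !pairingZl pairing0l Jh J0 mulr0 add0r => /eqP.
  by rewrite mulf_eq0 (gt_eqF vpos) orbF => /eqP.
by rewrite p0 q0 !raddf0 row_mx0.
Qed.

Lemma smooth_on_col_mx (R : realType) n (U : set 'rV[R]_n) m1 m2 k
    (A : 'rV[R]_n -> 'M[R]_(m1, k)) (B : 'rV[R]_n -> 'M[R]_(m2, k)) :
  open U -> smooth_on U A -> smooth_on U B ->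
  smooth_on U (fun u => col_mx (A u) (B u)).
Proof.
move=> openU As Bs; apply: (smooth_on_mx openU) => i j.
case: (split_ordP i) => i' ->.
- apply: (eq_smooth_on openU (f := fun u => A u i' j)).
    by move=> u _; rewrite col_mxEu.
  exact: smooth_on_entry.
- apply: (eq_smooth_on openU (f := fun u => B u i' j)).
    by move=> u _; rewrite col_mxEd.
  exact: smooth_on_entry.
Qed.

Section LocalOrthotoric.
Context {R : realType} (U : set 'rV[R]_4) (G J : 'rV[R]_4 -> 'M[R]_4).
Hypothesis openU : open U.
Hypothesis Gsmooth : smooth_on U G.
Hypothesis Gsym : forall u, U u -> (G u)^T = G u.
Hypothesis Gpos : forall u v, U u -> v != 0 -> 0 < pairing (G u) v v.
Hypothesis Jsmooth : smooth_on U J.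
Hypothesis J2 : forall u, U u -> J u *m J u = - 1%:M.
Hypothesis Jherm : forall u v w, U u ->
  pairing (G u) (v *m J u) (w *m J u) = pairing (G u) v w.
Hypothesis Jpar : parallel_on G U J.
Variables (xi eta : 'rV[R]_4 -> R) (K1 K2 : 'rV[R]_4 -> 'rV[R]_4).
Hypothesis xis : smooth_on U xi.
Hypothesis etas : smooth_on U eta.
Hypothesis K1s : smooth_on U K1.
Hypothesis K2s : smooth_on U K2.
Hypothesis K1k : killing_on G U K1.
Hypothesis K2k : killing_on G U K2.
Hypothesis K1m : forall u v, U u ->
  pairing (G u) (K1 u *m J u) v = - 'D_v (fun u => xi u * eta u) u.
Hypothesis K2m : forall u v, U u ->
  pairing (G u) (K2 u *m J u) v = - 'D_v (fun u => xi u + eta u) u.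
Hypothesis K12_rank : forall u, U u -> \rank (col_mx (K1 u) (K2 u)) = 2.
Hypothesis K12_poisson : forall u, U u ->
  pairing (G u) (K1 u *m J u) (K2 u) = 0.
Hypothesis dxi_deta : forall u, U u ->
  pairing (invmx (G u)) (\row_i pderiv i xi u) (\row_i pderiv i eta u) = 0.

Local Notation "'∇_' x Y" := (nabla G (cst x) Y)
  (at level 10, x at next level, Y at next level).

Let Gunit u : U u -> G u \in unitmx.
Proof. by move=> Uu; apply: pairing_unitmx => v; exact: Gpos. Qed.

Let a := gradient G xi.
Let b := gradient G eta.

Let as_ : smooth_on U a. Proof. exact: smooth_gradient. Qed.
Let bs : smooth_on U b. Proof. exact: smooth_gradient. Qed.

Let gC u x y : U u -> pairing (G u) x y = pairing (G u) y x.
Proof. by move=> Uu; apply: pairingC; exact: Gsym. Qed.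

Let ga u x : U u -> 'D_x xi u = pairing (G u) (a u) x.
Proof. by move=> Uu; rewrite -(pairing_gradient Gunit x xis Uu). Qed.

Let gb u x : U u -> 'D_x eta u = pairing (G u) (b u) x.
Proof. by move=> Uu; rewrite -(pairing_gradient Gunit x etas Uu). Qed.

Let pos u (Uu : U u) v : v != 0 -> 0 < pairing (G u) v v := @Gpos u v Uu.

Lemma killing_sum u : U u -> K2 u = (a u + b u) *m J u.
Proof.
move=> Uu; apply: oppr_inj; rewrite -mulNmx -(mulmxJJ (J2 Uu) (K2 u)).
congr (_ *m _); apply: (subr0_eq).
apply: (@pairing_nondegenerate _ _ (G u)) => [v|v]; first exact: Gpos.
rewrite pairingBl K2m// pairingNl pairingDl (@deriveD _ _ _ xi eta).
- by rewrite ga// gb// opprK addNr.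
- exact: smooth_on_derivable xis Uu.
- exact: smooth_on_derivable etas Uu.
Qed.

Lemma killing_prod u : U u -> K1 u = (xi u *: b u + eta u *: a u) *m J u.
Proof.
move=> Uu; apply: oppr_inj; rewrite -mulNmx -(mulmxJJ (J2 Uu) (K1 u)).
congr (_ *m _); apply: (subr0_eq).
apply: (@pairing_nondegenerate _ _ (G u)) => [v|v]; first exact: Gpos.
rewrite pairingBl K1m// pairingNl pairingDl !pairingZl (@deriveM _ _ xi eta).
- by rewrite ga// gb// opprK addNr.
- exact: smooth_on_derivable xis Uu.
- exact: smooth_on_derivable etas Uu.
Qed.

Let K_indep u s : U u -> K1 u != s *: K2 u.
Proof.
move=> Uu; apply/eqP => E; have := rank_proportional_rows (K2 u) s.
by rewrite -E K12_rank.
Qed.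

Let xi_neq_eta u : U u -> xi u != eta u.
Proof.
move=> Uu; apply/eqP => E; have := K_indep (eta u) Uu.
rewrite killing_prod// killing_sum// E scalemxAl -scalerDr [b u + _]addrC.
by rewrite eqxx.
Qed.

Let a0 u : U u -> a u != 0.
Proof.
move=> Uu; apply/eqP => E; have := K_indep (xi u) Uu.
by rewrite killing_prod// killing_sum// E scaler0 addr0 add0r scalemxAl eqxx.
Qed.

Let b0 u : U u -> b u != 0.
Proof.
move=> Uu; apply/eqP => E; have := K_indep (eta u) Uu.
by rewrite killing_prod// killing_sum// E scaler0 add0r addr0 scalemxAl eqxx.
Qed.

Let ab u : U u -> pairing (G u) (a u) (b u) = 0.
Proof. by move=> Uu; rewrite (pairing_gradients Gsym Gunit)// dxi_deta. Qed.

Let aJb u : U u -> pairing (G u) (a u *m J u) (b u) = 0.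
Proof.
move=> Uu; have D0 : xi u - eta u != 0 by rewrite subr_eq0 xi_neq_eta.
have gJl := pairing_Jl (J2 Uu) (fun v w => Jherm v w Uu).
apply: (mulfI D0); have := K12_poisson Uu.
rewrite killing_prod// killing_sum// (mulmxJJ (J2 Uu)).
rewrite !mulmxDl pairingNl !(pairingDl, pairingDr, pairingZl).
rewrite !(pairing_J0 (Gsym Uu) (J2 Uu) (fun v w => Jherm v w Uu)).
rewrite [pairing _ (a u) (b u *m _)]gC// [pairing _ (b u *m _) (a u)]gJl.
rewrite [pairing _ (b u) (a u *m _)]gC// => H; lra.
Qed.

Let P u x := (∇_x a) u.
Let Q u x := (∇_x b) u.
Let k u := 2 * (xi u - eta u).

Let nJ := nabla_J openU Jpar.
Let dp := derive_pairing openU Gsmooth Gsym Gunit.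
Let Jh u (Uu : U u) v w := Jherm v w Uu.

Let smoothJ (Y : 'rV[R]_4 -> 'rV[R]_4) :
  smooth_on U Y -> smooth_on U (fun u => Y u *m J u).
Proof. by move=> Ys; exact: (smooth_on_mulmx openU). Qed.

Let Psym u (Uu : U u) x y : pairing (G u) (P u x) y = pairing (G u) (P u y) x.
Proof. exact: (hessian_sym openU Gsmooth Gsym Gunit x y xis Uu). Qed.

Let Qsym u (Uu : U u) x y : pairing (G u) (Q u x) y = pairing (G u) (Q u y) x.
Proof. exact: (hessian_sym openU Gsmooth Gsym Gunit x y etas Uu). Qed.

Let PQ_J u (Uu : U u) x y :
  pairing (G u) ((P u x + Q u x) *m J u) y
  + pairing (G u) x ((P u y + Q u y) *m J u) = 0.
Proof.
have E z : (∇_z K2) u = (P u z + Q u z) *m J u.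
  transitivity ((∇_z (fun v => (a v + b v) *m J v)) u).
    by apply: (eq_nabla G openU z) Uu => v Uv; exact: killing_sum.
  by rewrite nJ ?(nablaD _ _ as_ bs Uu)//; exact: (smooth_on_addmx openU).
rewrite -!E; exact: (killing_nabla openU Gsmooth Gsym Gunit x y K2s K2k Uu).
Qed.

Let T u x := pairing (G u) (a u) x *: b u + xi u *: Q u x
  + (pairing (G u) (b u) x *: a u + eta u *: P u x).

Let T_J u (Uu : U u) x y :
  pairing (G u) (T u x *m J u) y + pairing (G u) x (T u y *m J u) = 0.
Proof.
have s1 := smooth_on_scalemx openU xis bs.
have s2 := smooth_on_scalemx openU etas as_.
have E z : (∇_z K1) u = T u z *m J u.
  transitivity ((∇_z (fun v => (xi v *: b v + eta v *: a v) *m J v)) u).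
    by apply: (eq_nabla G openU z) Uu => v Uv; exact: killing_prod.
  rewrite nJ//; last exact: (smooth_on_addmx openU).
  rewrite (nablaD _ _ s1 s2 Uu) (nablaZ _ _ xis bs Uu) (nablaZ _ _ etas as_ Uu).
  by rewrite ga// gb.
rewrite -!E; exact: (killing_nabla openU Gsmooth Gsym Gunit x y K1s K1k Uu).
Qed.

Let Pb_Qa u (Uu : U u) x :
  pairing (G u) (P u x) (b u) + pairing (G u) (a u) (Q u x) = 0.
Proof.
rewrite -(dp x as_ bs Uu) -(derive_cst (0 : R) u x).
by apply: near_eq_derive; apply: (near_open openU Uu) => v Uv; exact: ab.
Qed.

Let PJb_Qa u (Uu : U u) x :
  pairing (G u) (P u x *m J u) (b u) + pairing (G u) (a u *m J u) (Q u x) = 0.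
Proof.
rewrite -nJ// -(dp x (smoothJ as_) bs Uu) -(derive_cst (0 : R) u x).
by apply: near_eq_derive; apply: (near_open openU Uu) => v Uv; exact: aJb.
Qed.

Let ks : smooth_on U k.
Proof.
apply: (smooth_onM openU); first exact: smooth_on_cst.
apply: (eq_smooth_on openU (f := fun v => xi v + -1 * eta v)).
  by move=> v _; rewrite mulN1r.
apply: (smooth_onD openU) => //; apply: (smooth_onM openU) => //.
exact: smooth_on_cst.
Qed.

Let Dk u (Uu : U u) x :
  'D_x k u = 2 * (pairing (G u) x (a u) - pairing (G u) x (b u)).
Proof.
have dxi : derivable xi u x by exact: smooth_on_derivable xis Uu.
have deta : derivable eta u x by exact: smooth_on_derivable etas Uu.
rewrite /k (@deriveM _ _ (cst 2) (xi - eta)); last 2 first.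
- exact: derivable_cst.
- exact: (derivableB dxi deta).
rewrite derive_cst scaler0 addr0 (@deriveB _ _ _ xi eta)// ga// gb//.
by rewrite (gC _ x)// (gC _ x).
Qed.

Let nablaPb u z (Uu : U u) : k u * pairing (G u) ((∇_z a) u) (b u) =
  pairing (G u) (a u) (a u) * pairing (G u) z (b u) +
  pairing (G u) (b u) (b u) * pairing (G u) z (a u).
Proof.
exact: (hessian_Pb (Gsym Uu) (J2 Uu) (Jh Uu) (ab Uu) (aJb Uu)
  (Psym Uu) (Qsym Uu) (PQ_J Uu) (T_J Uu) (Pb_Qa Uu) (PJb_Qa Uu)).
Qed.

Let nablaPbJ u z (Uu : U u) : k u * pairing (G u) ((∇_z a) u) (b u *m J u) =
  pairing (G u) (a u) (a u) * pairing (G u) z (b u *m J u) +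
  pairing (G u) (b u) (b u) * pairing (G u) z ((- a u) *m J u).
Proof.
rewrite mulNmx pairingNr mulrN.
exact: (hessian_PbJ (Gsym Uu) (J2 Uu) (Jh Uu) (ab Uu) (aJb Uu)
  (Psym Uu) (Qsym Uu) (PQ_J Uu) (T_J Uu) (Pb_Qa Uu) (PJb_Qa Uu)).
Qed.

Let nas : smooth_on U (fun u => - a u).
Proof.
apply: (eq_smooth_on openU (f := fun v => (-1) *: a v)).
  by move=> v _; rewrite scaleN1r.
by apply: (smooth_on_scalemx openU) => //; exact: smooth_on_cst.
Qed.

Let nablaN u (Uu : U u) x : (∇_x (fun v => - a v)) u = - P u x.
Proof.
transitivity ((∇_x (fun v => (-1) *: a v)) u).
  by apply: (eq_nabla G openU x) Uu => v Uv; rewrite scaleN1r.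
have s1 : smooth_on U (fun _ => (-1) : R) by exact: smooth_on_cst.
by rewrite (nablaZ _ _ s1 as_ Uu) derive_cst scale0r add0r scaleN1r.
Qed.

Let c u := curvature_coef (G u) (a u) (b u) (P u) (Q u) (xi u) (eta u).

Let curv_ab u (Uu : U u) x y :
  pairing (G u) (a u *m curv_mx G x y u) (b u) = c u *
  (pairing (G u) x (a u) * pairing (G u) y (b u)
   - pairing (G u) x (b u) * pairing (G u) y (a u)
   + pairing (G u) x (a u *m J u) * pairing (G u) y (b u *m J u)
   - pairing (G u) x (b u *m J u) * pairing (G u) y (a u *m J u)).
Proof.
apply: (curvature_ab_of_hessians (Gsym Uu) (pos Uu) (J2 Uu)
  (Jh Uu) (ab Uu) (aJb Uu) (a0 Uu) (b0 Uu) (xi_neq_eta Uu)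
  (Psym Uu) (Qsym Uu) (PQ_J Uu) (T_J Uu) (Pb_Qa Uu) (PJb_Qa Uu)).
rewrite (curvature_of_hessian_identity openU Gsmooth Gsym Gunit x y
  ks as_ bs bs as_ Uu nablaPb) /= !Dk//.
by rewrite -/(P u x) -/(P u y) -/(Q u x) -/(Q u y) /k !mulNr.
Qed.

Let curv_abJ u (Uu : U u) x y :
  pairing (G u) (a u *m curv_mx G x y u) (b u *m J u) = c u *
  (pairing (G u) x (a u) * pairing (G u) y (b u *m J u)
   - pairing (G u) x (b u *m J u) * pairing (G u) y (a u)
   - pairing (G u) x (a u *m J u) * pairing (G u) y (b u)
   + pairing (G u) x (b u) * pairing (G u) y (a u *m J u)).
Proof.
apply: (curvature_abJ_of_hessians (Gsym Uu) (pos Uu) (J2 Uu)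
  (Jh Uu) (ab Uu) (aJb Uu) (a0 Uu) (b0 Uu) (xi_neq_eta Uu)
  (Psym Uu) (Qsym Uu) (PQ_J Uu) (T_J Uu) (Pb_Qa Uu) (PJb_Qa Uu)).
rewrite (curvature_of_hessian_identity openU Gsmooth Gsym Gunit x y
  ks as_ bs (smoothJ bs) (smoothJ nas) Uu nablaPbJ) /= !Dk//.
rewrite (nJ x bs Uu) (nJ y bs Uu) (nJ x nas Uu) (nJ y nas Uu).
rewrite (nablaN Uu x) (nablaN Uu y).
rewrite -/(P u x) -/(P u y) -/(Q u x) -/(Q u y) /k.
move: (P u x) (P u y) (Q u x) (Q u y) => p p' q q'.
move: (a u) (b u) (xi u) (eta u) => a' b' xi' eta'.
rewrite !mulNmx !pairingNl !pairingNr.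
by ring.
Qed.

(** The pointwise algebra applies at every point of U to P = nabla a and
Q = nabla b; the same algebra at all points of U yields the two identities that
are differentiated to obtain curv_ab and curv_abJ. *)
Lemma local_curvature u : U u -> exists f : R -> R -> R, forall X,
  pairing (G u) (X *m J u *m curv_mx G X (X *m J u) u) X =
  f (line_normsq (G u) (J u) (a u) X) (line_perp_normsq (G u) (J u) (b u) X).
Proof.
move=> Uu; apply: (holomorphic_sectional_frame (Gsym Uu) (pos Uu) (J2 Uu)
  (Jh Uu) (ab Uu) (aJb Uu) (a0 Uu) (b0 Uu)
   (C := fun x y => curv_mx G x y u) (c := c u)).
- by move=> x y; exact: curv_mxC.
- by move=> x y z w; exact: (curv_mx_skew openU).
- by move=> x y z; exact: (curv_mx_bianchi openU).
- by move=> x y z; exact: (curv_mx_J openU Gsmooth Gunit Jsmooth Jpar).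
- exact: curv_ab.
- exact: curv_abJ.
Qed.

(** A generator of D that is a combination of the given vector fields with a
function as coefficient, so that its behaviour under changes of charts and its
smoothness are immediate. *)
Definition line_generator u := K1 u - xi u *: K2 u.

Lemma line_generatorE u : U u ->
  line_generator u = (eta u - xi u) *: (a u *m J u).
Proof.
move=> Uu; rewrite /line_generator killing_prod// killing_sum//.
rewrite scalemxAl -mulmxBl scalemxAl; congr (_ *m _).
by apply/rowP => i; rewrite !mxE; ring.
Qed.

Lemma smooth_line_generator : smooth_on U line_generator.
Proof.
apply: (eq_smooth_on openU (f := fun u => K1 u + (-1 * xi u) *: K2 u)).
  by move=> u _; rewrite mulN1r scaleNr.
apply: (smooth_on_addmx openU) => //; apply: (smooth_on_scalemx openU) => //.
by apply: (smooth_onM openU) => //; exact: smooth_on_cst.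
Qed.

Lemma line_generator_pos u : U u ->
  0 < pairing (G u) (line_generator u) (line_generator u).
Proof.
move=> Uu; apply: Gpos => //; rewrite line_generatorE// scaler_eq0 negb_or.
rewrite subr_eq0 eq_sym xi_neq_eta//=; apply: contraNneq (a0 Uu) => E.
by rewrite -oppr_eq0 -(mulmxJJ (J2 Uu) (a u)) E mul0mx.
Qed.

(** X and its projection have the same products with a and J a, while the
projection is orthogonal to b and J b; the second equality is then the
Parseval identity for the unit vector X. *)
Lemma projection_norm u X XD : U u -> pairing (G u) X X = 1 ->
  is_orth_proj (G u) (complex_line (line_generator u) (J u)) X XD ->
  line_normsq (G u) (J u) (a u) X = pairing (G u) (a u) (a u) * pairing (G u) XD XD /\
  line_perp_normsq (G u) (J u) (b u) X =
    pairing (G u) (b u) (b u) * (1 - pairing (G u) XD XD).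
Proof.
move=> Uu X1 [XDD Porth].
have D0 : eta u - xi u != 0 by rewrite subr_eq0 eq_sym xi_neq_eta.
have al0 : pairing (G u) (a u) (a u) != 0 by rewrite gt_eqF// Gpos// a0.
have be0 : pairing (G u) (b u) (b u) != 0 by rewrite gt_eqF// Gpos// b0.
have gJl := pairing_Jl (J2 Uu) (Jh Uu).
have inD v : (v <= complex_line (line_generator u) (J u))%MS =
    (v <= col_mx (a u *m J u) (a u))%MS.
  rewrite genmxE line_generatorE// -scalemxAl (mulmxJJ (J2 Uu)).
  have E : (col_mx ((eta u - xi u) *: (a u *m J u)) ((eta u - xi u) *: - a u)
      :=: col_mx (a u *m J u) (a u))%MS.
    apply: eqmx_trans (eqmx_sym (addsmxE _ _)) _.
    apply: eqmx_trans _ (addsmxE _ _); apply: adds_eqmx; first exact: eqmx_scale.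
    exact: eqmx_trans (eqmx_scale _ D0) (eqmx_opp _).
  by rewrite E.
have e1 : pairing (G u) X (a u) = pairing (G u) XD (a u).
  apply/eqP; rewrite -subr_eq0 -pairingBl Porth ?inD//.
  by rewrite -addsmxE addsmxSr.
have e2 : pairing (G u) X (a u *m J u) = pairing (G u) XD (a u *m J u).
  apply/eqP; rewrite -subr_eq0 -pairingBl Porth ?inD//.
  by rewrite -addsmxE addsmxSl.
move: XDD; rewrite inD => /submxP[w]; rewrite -[w]hsubmxK mul_row_col.
rewrite [lsubmx w]mx11_scalar [rsubmx w]mx11_scalar !mul_scalar_mx => XDE.
have e3 : pairing (G u) XD (b u) = 0.
  by rewrite XDE pairingDl !pairingZl ab// aJb// !mulr0 addr0.
have e4 : pairing (G u) XD (b u *m J u) = 0.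
  rewrite XDE pairingDl !pairingZl Jh// ab// mulr0 add0r.
  by rewrite -[pairing _ _ _]opprK -gJl aJb// oppr0 mulr0.
have ps := parseval (Gsym Uu) (pos Uu) (J2 Uu) (Jh Uu) (ab Uu) (aJb Uu)
  (a0 Uu) (b0 Uu).
have XDXD := ps XD XD; have XX := ps X X.
rewrite e3 e4 -e1 -e2 in XDXD; rewrite X1 in XX.
move: al0 be0 XX; rewrite /line_normsq /line_perp_normsq XDXD.
move: (pairing _ X (a u)) (pairing _ X (a u *m _)) => x1 x2.
move: (pairing _ X (b u)) (pairing _ X (b u *m _)) => x3 x4.
move: (pairing _ (a u) (a u)) (pairing _ (b u) (b u)) => al be al0 be0 XX.
split; first by field; rewrite al0 be0.
transitivity (be * ((x3 * x3 + x4 * x4) / be)); first by field.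
by congr (_ * _); rewrite [X in X - _]XX; ring.
Qed.

Lemma local_holomorphic_sectional u X Y XD YD : U u ->
  pairing (G u) X X = 1 -> pairing (G u) Y Y = 1 ->
  is_orth_proj (G u) (complex_line (line_generator u) (J u)) X XD ->
  is_orth_proj (G u) (complex_line (line_generator u) (J u)) Y YD ->
  pairing (G u) XD XD = pairing (G u) YD YD ->
  curvature (G) u X (X *m J u) (X *m J u) X =
  curvature (G) u Y (Y *m J u) (Y *m J u) Y.
Proof.
move=> Uu X1 Y1 XP YQ XDYD; have [f fE] := local_curvature Uu.
rewrite !(curvatureE openU Gsmooth Gunit)// !fE.
have [-> ->] := projection_norm Uu X1 XP.
by have [-> ->] := projection_norm Uu Y1 YQ; rewrite XDYD.
Qed.

End LocalOrthotoric.

Theorem theorem4 (R : realType) (M : kahler_surface R) :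
  connected [set: M] -> orthotoric M -> QCH M.
Proof.
move=> Mconn [xi [eta [K1 [K2 [[xis etas]
  [[[K1s K1t] K1k K1m] [[K2s K2t] K2k K2m]] Krank Kpoisson dxi_deta]]]]].
split=> //.
have [Gs Gt Gsym Gpos] := kmetricP M.
have [Js Jt] := kcomplexP M.
pose N c := line_generator (xi \o cinv c) (K1 c) (K2 c).
have openc (c : chart M) : open (cimg c) by exact: cimg_open.
have xisc c : smooth_on (cimg c) (xi \o cinv c) by exact: xis.
have etasc c : smooth_on (cimg c) (eta \o cinv c) by exact: etas.
have m1 (c : chart M) u v : cimg c u ->
    pairing (kmetric c u) (K1 c u *m kcomplex c u) v =
    - 'D_v (fun u => (xi \o cinv c) u * (eta \o cinv c) u) u.
  exact: K1m.
have m2 (c : chart M) u v : cimg c u ->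
    pairing (kmetric c u) (K2 c u *m kcomplex c u) v =
    - 'D_v (fun u => (xi \o cinv c) u + (eta \o cinv c) u) u.
  exact: K2m.
have J2 (c : chart M) u : cimg c u -> kcomplex c u *m kcomplex c u = - 1%:M.
  exact: kcomplex_sqr.
have Jh (c : chart M) u v w : cimg c u ->
    pairing (kmetric c u) (v *m kcomplex c u) (w *m kcomplex c u) =
    pairing (kmetric c u) v w.
  exact: khermitian.
have Npos c u : cimg c u -> 0 < pairing (kmetric c u) (N c u) (N c u).
  exact: (line_generator_pos (Gpos c) (J2 c) (xisc c) (etasc c)
    (m1 c) (m2 c) (Krank c)).
have Ns c : smooth_on (cimg c) (N c).
  exact: (smooth_line_generator (openc c) (xisc c) (K1s c) (K2s c)).
have Nt c c' x : overlap c c' x ->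
    N c (cmap c x) *m cjac c c' x = N c' (cmap c' x).
  move=> cc'x; rewrite /N /line_generator mulmxBl -scalemxAl K1t// K2t//=.
  by case: cc'x => cx c'x; rewrite !cmapK.
exists (fun c u => complex_line (N c u) (kcomplex c u)); split.
- split.
  + move=> c u cu; apply: (complex_line_rank (Gsym c u cu) (J2 c u cu)).
      by move=> x y; exact: Jh.
    exact: Npos.
  + move=> c c' x cc'x; apply/eqmxP.
    apply: eqmx_trans (eqmxMr _ (genmxE _)) _.
    apply: eqmx_trans _ (eqmx_sym (genmxE _)).
    by rewrite mul_col_mx -mulmxA Jt// mulmxA Nt//; exact: eqmx_refl.
  + move=> c u cu; exists (cimg c), (fun u => col_mx (N c u) (N c u *m kcomplex c u)).
    split=> //.
      exact: (smooth_on_col_mx (openc c) (Ns c)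
        (smooth_on_mulmx (openc c) (Ns c) (Js c))).
    by move=> u' _; apply/eqmxP; exact: (eqmx_sym (genmxE _)).
- by move=> c u cu; exact/complex_line_invariant/J2.
- move=> c u cu X Y P Q X1 Y1 XP YQ /(congr1 (fun x => x ^+ 2)).
  have ge0 v : 0 <= pairing (kmetric c u) v v.
    have [->|v0] := eqVneq v 0; first by rewrite pairing0l.
    by rewrite ltW// Gpos.
  rewrite !sqr_sqrtr// => PQ.
  exact: (local_holomorphic_sectional (openc c) (Gs c) (Gsym c) (Gpos c) (Js c)
    (J2 c) (Jh c) (@kparallel _ _ M c) (xisc c) (etasc c) (K1s c) (K2s c)
    (@K1k c) (@K2k c)
    (m1 c) (m2 c) (Krank c) (Kpoisson c) (dxi_deta c) cu X1 Y1 XP YQ PQ).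
Qed.
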